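(* Let $p\in(1,\infty)$, and for $q\in(1,\infty)$ let $$I_p(q):=q^{1/p}\int_0^\infty\left|\frac{\sin_p x}{x}\right|^q\,\mathrm{d}x .$$ There exist constants $\gamma_3,\gamma_4,\ldots$ such that for $q$ large enough $$I_p(q)\sim (p(p+1))^{1/p}\left(\frac1p\Gamma\!\left(\frac1p\right)+\frac1p\Gamma\!\left(\frac1p\right)\frac{(-p^2+p+1)(p+1)}{2p(2p+1)}\,\frac1q+\sum_{j=3}^\infty\Gamma\!\left(j+\frac1p\right)\frac{\gamma_j}{q^j}\right).$$
   Context: For $p\in(1,\infty)$, define $F_p:[0,1]\to[0,\pi_p/2]$ by $F_p(y)=\int_0^y(1-t^p)^{-1/p}\,\mathrm{d}t$, where $\pi_p:=2F_p(1)=\frac{2\pi}{p\sin(\pi/p)}$. The generalised sine function $\sin_p$ is defined on $[0,\pi_p/2]$ as the inverse of $F_p$, and is extended to all of $\mathbb{R}$ as a $2\pi_p$-periodic function by the rules $\sin_p(-x)=-\sin_p(x)$ and $\sin_p(\frac{\pi_p}{2}-x)=\sin_p(\frac{\pi_p}{2}+x)$. $\Gamma$ is the Gamma function. The variable $q$ is real. The symbol $\sim$ denotes an asymptotic expansion as $q\to\infty$.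
   Formalization: The printed expansion has no 1/q^2 term and is false as it stands (for p=2 the relative 1/q^2 coefficient is -13/1120, not 0); the formal theorem starts the sum at j=2 instead of j=3, with constants gamma_2, gamma_3, .... *)

(* Defs.v *)
From HB Require Import structures.
From mathcomp Require Import all_boot all_order all_algebra.
From mathcomp Require Import all_classical all_reals all_analysis.
Set Implicit Arguments.
Unset Strict Implicit.
Unset Printing Implicit Defensive.
Import Order.TTheory GRing.Theory Num.Theory.
Import numFieldNormedType.Exports.
Local Open Scope classical_set_scope.
Local Open Scope ring_scope.

Definition Gamma (R : realType) (z : R) : R :=
  \int[lebesgue_measure]_(t in `]0, +oo[) (t `^ (z - 1) * expR (- t)).

(* At t = 1 the integrand is [0 `^ _ = 0] rather than +oo; this is a null set. *)
Definition Fp (R : realType) (p y : R) : R :=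
  \int[lebesgue_measure]_(t in `[0, y]) (1 - t `^ p) `^ (- p^-1).

Definition pip (R : realType) (p : R) : R := 2 * Fp p 1.

(* Inverse of [Fp p] : [0, 1] -> [0, pip p / 2]. *)
Definition arc_sinp (R : realType) (p : R) : R -> R :=
  'pinv_(fun=> 0) `[0, 1] (Fp p).

(* The point [y] is the representative of [x] modulo [2 * pip p] lying in
   [- pip p, pip p[.  By oddness the value at [y] is determined by the one at
   [`|y|] in [0, pip p], and by symmetry about [pip p / 2] the latter is the
   value at whichever of [`|y|], [pip p - `|y|] lies in [0, pip p / 2]. *)
Definition sinp (R : realType) (p x : R) : R :=
  let y := x - 2 * pip p * (Num.floor (x / (2 * pip p) + 2^-1))%:~R in
  Num.sg y * arc_sinp p (Num.min `|y| (pip p - `|y|)).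

Definition Ip (R : realType) (p q : R) : R :=
  q `^ p^-1 *
  \int[lebesgue_measure]_(x in `]0, +oo[) `|sinp p x / x| `^ q.

(* Poincare expansion f(q) ~ \sum_(j >= 0) a_j / q^j as q -> +oo: for every N,
   f(q) - \sum_(j <= N) a_j / q^j = o(q^-N). *)
Definition asymptotic_expansion (R : realType) (f : R -> R) (a : nat -> R)
    : Prop :=
  forall N : nat,
    (f q - \sum_(j < N.+1) a j / q ^+ j) / q ^- N @[q --> +oo] --> (0 : R).

(* Main.v *)
Require Import Defs.
From HB Require Import structures.
From mathcomp Require Import all_boot all_order all_algebra.
From mathcomp Require Import all_classical all_reals all_analysis measurable_realfun.
From mathcomp Require Import ring lra.
Set Implicit Arguments.
Unset Strict Implicit.
Unset Printing Implicit Defensive.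
Import Order.TTheory GRing.Theory Num.Theory.
Import numFieldNormedType.Exports.
Local Open Scope classical_set_scope.
Local Open Scope ring_scope.

(* Write F = Fp p.  By layer cake,
     I_p(q) = q^(1/p) \int_0^oo q e^(-q r) M(r) dr,
   where M(r) is the measure of {x > 0 : |sin_p x / x| > e^-r}.  Always
   M(r) <= e^r, because |sin_p x / x| <= 1/x.  For 0 < r < ln F(1) the set is
   the interval ]0, F y[, where y in ]0, 1[ is the solution of F y = e^r y, so
   that M(r) = F y, and the theorem follows from Watson's lemma once F y has
   been expanded at 0 as s^(1/p) times a power series in s = ln (F y / y).
   Put u = y^p.  The binomial series gives F y / y - 1 = a u + b u^2 + ... with
   a = 1/(p (p + 1)) and b = (p + 1)/(2 p^2 (2 p + 1)), and the left-hand side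
   is e^s - 1.  Inverting this relation expands u in powers of s, and then
   F y = y e^s = s^(1/p) (u / s)^(1/p) e^s. *)

(** * Asymptotic expansions in powers of a small function *)

(** The map from s back to y is never built. Everything is a function of y near 0+, and expansions
    are measured against a gauge that is itself a function of y, so passing from powers of u to
    powers of s is a change of gauge. No series has to converge either: only expansions to each
    finite order occur, and a u + b u^2 + ... = e^s - 1 is inverted by a fixed-point iteration that
    gains one order per round. The coefficients needed for the 1/q term then follow by comparing two
    expansions of e^s - 1 in s. The set behind M(r) is an interval because F y / y, the mean over
    ]0, y[ of an increasing integrand, is strictly increasing. Past F(1) the size of sin_p enters
    only through |sin_p| <= 1, which gives a ratio of at most 1/F(1) < e^-r. The crude bound M(r) <=
    e^r, valid for every r, replaces any study of M away from 0; in Watson's lemma it merely lowers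
    the rate q to q - 1 in the remainder. *)

Section poly_bounds.
Context {R : realType}.
Implicit Types P Q : {poly R}.

Lemma poly_bounded P :
  exists2 C : R, 0 <= C & forall x, `|x| <= 1 -> `|P.[x]| <= C.
Proof.
elim/poly_ind: P => [|P c [C C0 hC]].
  by exists 0 => // x _; rewrite horner0 normr0.
exists (C + `|c|) => [|x x1]; first by rewrite addr_ge0.
rewrite hornerMXaddC (le_trans (ler_normD _ _))// lerD2r normrM.
by rewrite -[leRHS]mulr1 ler_pM// hC.
Qed.

Lemma poly_lipschitz P : exists2 C : R, 0 <= C &
  forall x y, `|x| <= 1 -> `|y| <= 1 -> `|P.[x] - P.[y]| <= C * `|x - y|.
Proof.
elim/poly_ind: P => [|P c [C C0 hC]].
  by exists 0 => // x y _ _; rewrite !horner0 subrr normr0 mul0r.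
have [B B0 hB] := poly_bounded P.
exists (C + B) => [|x y x1 y1]; first by rewrite addr_ge0.
rewrite !hornerMXaddC.
have -> : P.[x] * x + c - (P.[y] * y + c) =
  (P.[x] - P.[y]) * x + P.[y] * (x - y) by ring.
rewrite (le_trans (ler_normD _ _))// !normrM mulrDl lerD//.
  by rewrite -[leRHS]mulr1 ler_pM// hC.
by rewrite ler_wpM2r// hB.
Qed.

End poly_bounds.

Section big_oh.
Context {R : realType} {T : Type} (F : set_system T) {FF : ProperFilter F}.
Implicit Types (t s g h : T -> R) (P Q : {poly R}) (n m : nat).

(** The gauge [t] is a function on the same filtered set as [g], not the variable itself: one
    function can then be measured against several gauges without inverting any of them. *)
Definition bigoh n t g := exists2 C : R, 0 <= C &
  \forall x \near F, `|g x| <= C * `|t x| ^+ n.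

(** For a gauge tending to 0, [P] matters only modulo ['X^n]. Its degree is left free, so that
    products and compositions need no truncation. *)
Definition expands n t g P := bigoh n t (fun x => g x - P.[t x]).

Lemma bigoh_near n t g h :
  (\forall x \near F, g x = h x) -> bigoh n t g -> bigoh n t h.
Proof.
move=> gh [C C0 hC]; exists C => //.
by move: gh hC; apply: filterS2 => x ->.
Qed.

Lemma bigohD n t g h :
  bigoh n t g -> bigoh n t h -> bigoh n t (fun x => g x + h x).
Proof.
move=> [C C0 hC] [D D0 hD]; exists (C + D); first exact: addr_ge0.
move: hC hD; apply: filterS2 => x gC hD.
by rewrite mulrDl (le_trans (ler_normD _ _))// lerD.
Qed.

Lemma bigohN n t g : bigoh n t g -> bigoh n t (fun x => - g x).
Proof.
move=> [C C0 hC]; exists C => //.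
by move: hC; apply: filterS => x; rewrite normrN.
Qed.

Lemma bigohB n t g h :
  bigoh n t g -> bigoh n t h -> bigoh n t (fun x => g x - h x).
Proof. by move=> gO hO; apply: bigohD => //; exact: bigohN. Qed.

Lemma bigohM m n t g h :
  bigoh m t g -> bigoh n t h -> bigoh (m + n) t (fun x => g x * h x).
Proof.
move=> [C C0 hC] [D D0 hD]; exists (C * D); first exact: mulr_ge0.
move: hC hD; apply: filterS2 => x gC hD.
by rewrite normrM exprD mulrACA ler_pM.
Qed.

Lemma bigoh_cst t (c : R) : bigoh 0 t (fun=> c).
Proof. by exists `|c| => //; apply: nearW => x; rewrite expr0 mulr1. Qed.

Lemma bigohZ n t g (c : R) : bigoh n t g -> bigoh n t (fun x => c * g x).
Proof. by move=> gO; rewrite -(add0n n); apply: bigohM => //; exact: bigoh_cst. Qed.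

Lemma bigoh_exp n t : bigoh n t (fun x => t x ^+ n).
Proof. by exists 1 => //; apply: nearW => x; rewrite mul1r normrX. Qed.

Lemma near_le1 t : t x @[x --> F] --> (0 : R) ->
  \forall x \near F, `|t x| <= 1.
Proof. by move=> /cvgr0_norm_le; apply; exact: ltr01. Qed.

Lemma bigoh_le m n t g : t x @[x --> F] --> (0 : R) -> (m <= n)%N ->
  bigoh n t g -> bigoh m t g.
Proof.
move=> t0 mn [C C0 hC]; exists C => //.
move: hC (near_le1 t0); apply: filterS2 => x gC t1.
by rewrite (le_trans gC)// ler_wpM2l// ler_wiXn2l.
Qed.

Lemma bigoh_trans n t s g : bigoh 1 t s -> bigoh n s g -> bigoh n t g.
Proof.
move=> [C C0 hC] [D D0 hD]; exists (D * C ^+ n).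
  by rewrite mulr_ge0// exprn_ge0.
move: hC hD; apply: filterS2 => x sC gD.
rewrite (le_trans gD)// -mulrA ler_wpM2l// -exprMn.
by rewrite lerXn2r// ?nnegrE ?mulr_ge0// (le_trans sC)// expr1.
Qed.

Lemma bigoh1_cvg t s : t x @[x --> F] --> (0 : R) -> bigoh 1 t s ->
  s x @[x --> F] --> (0 : R).
Proof.
move=> t0 [C C0 hC]; apply/cvgr0Pnorm_le => e e0.
have eC : 0 < e / (C + 1) by rewrite divr_gt0// ltr_wpDl.
near=> x.
have te : `|t x| <= e / (C + 1) by near: x; exact: cvgr0_norm_le.
rewrite (@le_trans _ _ (C * `|t x| ^+ 1))//; first by near: x.
rewrite expr1 (le_trans (ler_wpM2l C0 te))//.
by rewrite mulrCA ger_pMr// ler_pdivrMr ?mul1r ?lerDl// ltr_wpDl.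
Unshelve. all: by end_near. Qed.

Lemma bigoh_poly t P : t x @[x --> F] --> (0 : R) ->
  bigoh 0 t (fun x => P.[t x]).
Proof.
move=> t0; have [C C0 hC] := poly_bounded P; exists C => //.
by move: (near_le1 t0); apply: filterS => x tx; rewrite expr0 mulr1 hC.
Qed.

Lemma poly_dropE n P (x : R) :
  P.[x] = \sum_(i < n) P`_i * x ^+ i + x ^+ n * (drop_poly n P).[x].
Proof.
rewrite -{1}(poly_take_drop n P) hornerD hornerM hornerXn mulrC; congr (_ + _).
rewrite (horner_coef_wide _ (size_take_poly n P)); apply: eq_bigr => i _.
by rewrite coef_take_poly ltn_ord.
Qed.

Lemma bigoh_poly_lt n t P : t x @[x --> F] --> (0 : R) ->
  (forall i, (i < n)%N -> P`_i = 0) -> bigoh n t (fun x => P.[t x]).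
Proof.
move=> t0 P0.
apply: (@bigoh_near _ _ (fun x => t x ^+ n * (drop_poly n P).[t x])).
  apply: nearW => x; rewrite [RHS](poly_dropE n) big1 ?add0r// => i _.
  by rewrite P0// mul0r.
by rewrite -[n in bigoh n]addn0; apply: bigohM; [exact: bigoh_exp|exact: bigoh_poly].
Qed.

(** Both arguments end up in [-1, 1], where [P] is Lipschitz. *)
Lemma bigoh_lipschitz n t g h P :
  g x @[x --> F] --> (0 : R) -> h x @[x --> F] --> (0 : R) ->
  bigoh n t (fun x => g x - h x) ->
  bigoh n t (fun x => P.[g x] - P.[h x]).
Proof.
move=> g0 h0 [D D0 hD]; have [C C0 hC] := poly_lipschitz P.
exists (C * D); first exact: mulr_ge0.
near=> x; rewrite (@le_trans _ _ (C * `|g x - h x|))//.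
  by apply: hC; near: x; exact: near_le1.
by rewrite -mulrA ler_wpM2l//; near: x.
Unshelve. all: by end_near. Qed.

Lemma expands_le m n t g P : t x @[x --> F] --> (0 : R) -> (m <= n)%N ->
  expands n t g P -> expands m t g P.
Proof. exact: bigoh_le. Qed.

Lemma expands_bigoh0 n t g P : t x @[x --> F] --> (0 : R) ->
  expands n t g P -> bigoh 0 t g.
Proof.
move=> t0 /(bigoh_le t0 (leq0n n)) gP.
apply: (bigoh_near _ (bigohD gP (bigoh_poly P t0))).
by apply: nearW => x; rewrite subrK.
Qed.

Lemma expands_bigoh1 n t g P : t x @[x --> F] --> (0 : R) -> (0 < n)%N ->
  P`_0 = 0 -> expands n t g P -> bigoh 1 t g.
Proof.
move=> t0 n0 P0 /(bigoh_le t0 n0) gP.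
have /(bigohD gP) : bigoh 1 t (fun x => P.[t x]).
  by apply: bigoh_poly_lt => // i; rewrite ltnS leqn0 => /eqP->.
by apply: bigoh_near; apply: nearW => x; rewrite subrK.
Qed.

Lemma expandsB n t g h P Q : expands n t g P -> expands n t h Q ->
  expands n t (fun x => g x - h x) (P - Q).
Proof.
move=> gP hQ; apply: (bigoh_near _ (bigohB gP hQ)).
by apply: nearW => x; rewrite hornerD hornerN; ring.
Qed.

Lemma expandsZ n t g P (c : R) : expands n t g P ->
  expands n t (fun x => c * g x) (c *: P).
Proof.
move=> gP; apply: (bigoh_near _ (bigohZ c gP)).
by apply: nearW => x; rewrite hornerZ mulrBr.
Qed.

Lemma expandsM n t g h P Q : t x @[x --> F] --> (0 : R) ->
  expands n t g P -> expands n t h Q ->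
  expands n t (fun x => g x * h x) (P * Q).
Proof.
move=> t0 gP hQ.
have h0 := expands_bigoh0 t0 hQ.
have := bigohM gP h0; rewrite addn0.
move=> /bigohD /(_ (bigohM (bigoh_poly P t0) hQ)); apply: bigoh_near; apply: nearW => x.
by rewrite hornerM; ring.
Qed.

Lemma expands_cst n t (c : R) : expands n t (fun=> c) c%:P.
Proof.
by exists 0 => //; apply: nearW => x; rewrite hornerC subrr normr0 mul0r.
Qed.

(** Split g - P(Q(t)) as (g - P(s)) + (P(s) - P(Q(t))). The first part is O(s^n), hence O(t^n),
    since the vanishing constant term of [Q] makes s = O(t); the second is controlled by s -
    Q(t). *)
Lemma expands_comp n t s g P Q : t x @[x --> F] --> (0 : R) -> (0 < n)%N ->
  Q`_0 = 0 -> expands n t s Q -> expands n s g P -> expands n t g (P \Po Q).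
Proof.
move=> t0 n0 Q0 sQ gP.
have s1 := expands_bigoh1 t0 n0 Q0 sQ.
have Q1 : bigoh 1 t (fun x => Q.[t x]).
  by apply: bigoh_poly_lt => // i; rewrite ltnS leqn0 => /eqP->.
have PQ := bigoh_lipschitz P (bigoh1_cvg t0 s1) (bigoh1_cvg t0 Q1) sQ.
apply: (bigoh_near _ (bigohD (bigoh_trans s1 gP) PQ)).
by apply: nearW => x; rewrite horner_comp; ring.
Qed.

(** Dividing by the gauge costs one order, hence the hypothesis at [n.+1]. *)
Lemma expands_divX n t s Q : (\forall x \near F, t x != 0) ->
  Q`_0 = 0 -> expands n.+1 t s Q ->
  expands n t (fun x => s x / t x) (drop_poly 1 Q).
Proof.
move=> t_neq0 Q0 [C C0 hC]; exists C => //.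
move: t_neq0 hC; apply: filterS2 => x tx.
rewrite (poly_dropE 1 Q) big_ord1 Q0 mul0r add0r expr1.
have -> : s x - t x * (drop_poly 1 Q).[t x] =
  (s x / t x - (drop_poly 1 Q).[t x]) * t x by field.
by rewrite normrM exprS mulrCA mulrC ler_pM2l ?normr_gt0.
Qed.

(** The lowest nonzero coefficient would dominate: once the coefficients below [i] vanish, the i-th
    one is at most (C + D) |t| in absolute value, and the gauge [t] tends to 0 without vanishing. *)
Lemma bigoh_coef0 n t P : t x @[x --> F] --> (0 : R) ->
  (\forall x \near F, t x != 0) -> bigoh n t (fun x => P.[t x]) ->
  forall i, (i < n)%N -> P`_i = 0.
Proof.
move=> t0 t_neq0 PO i; elim/ltn_ind: i => i IH iltn.
have [[C C0 hC] [D D0 hD]] : bigoh i.+1 t (fun x => P.[t x]) /\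
    bigoh 0 t (fun x => (drop_poly i.+1 P).[t x]).
  by split; [exact: bigoh_le PO|exact: bigoh_poly].
apply/eqP/negPn/negP => Pi0.
have CD1 : 0 < C + D + 1 by rewrite ltr_wpDl// addr_ge0.
have e0 : 0 < `|P`_i| / (C + D + 1) by rewrite divr_gt0// normr_gt0.
near F => x.
have tx0 : t x != 0 by near: x.
have : `|P`_i * t x ^+ i| <= (C + D) * `|t x| ^+ i.+1.
  have -> : P`_i * t x ^+ i = P.[t x] - t x ^+ i.+1 * (drop_poly i.+1 P).[t x].
    rewrite (poly_dropE i.+1 P) big_ord_recr/= big1 ?add0r ?addrK// => j _.
    by rewrite IH ?mul0r// (ltn_trans _ iltn).
  rewrite (le_trans (ler_normB _ _))// mulrDl lerD//; first by near: x.
  rewrite normrM normrX mulrC ler_wpM2r// -[leRHS]mulr1 -(expr0 `|t x|).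
  by near: x.
rewrite normrM normrX exprS mulrA ler_pM2r ?exprn_gt0 ?normr_gt0//.
apply/negP; rewrite -ltNge.
have tlt : `|t x| < `|P`_i| / (C + D + 1).
  by near: x; exact: (cvgr0_norm_lt _ t0).
rewrite (@le_lt_trans _ _ ((C + D + 1) * `|t x|))//.
  by rewrite ler_wpM2r// lerDl.
by rewrite mulrC -ltr_pdivlMr.
Unshelve. all: by end_near. Qed.

Lemma expands_uniq n t g P Q : t x @[x --> F] --> (0 : R) ->
  (\forall x \near F, t x != 0) -> expands n t g P -> expands n t g Q ->
  forall i, (i < n)%N -> P`_i = Q`_i.
Proof.
move=> t0 t_neq0 gP gQ i iltn; apply/eqP; rewrite -subr_eq0 -coefB.
apply/eqP; apply: (bigoh_coef0 t0 t_neq0 _ iltn).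
apply: (bigoh_near _ (bigohB gQ gP)).
by apply: nearW => x; rewrite hornerD hornerN; ring.
Qed.

(* If [s = c t + A t] with [A = O(t^2)], then [t = c^-1 (s - A t)] turns an
   expansion of [t] in powers of [s] into one with one more term. *)
Lemma expands_inv t s (c : R) : t x @[x --> F] --> (0 : R) -> c != 0 ->
  (forall n, exists P, [/\ expands n t s P, P`_0 = 0 & P`_1 = c]) ->
  forall n, exists2 Q, expands n s t Q & Q`_0 = 0.
Proof.
move=> t0 c0 sP.
have s1 : bigoh 1 t s.
  by have [P [+ P0 _]] := sP 1; exact: (expands_bigoh1 t0).
have s0 := bigoh1_cvg t0 s1.
have t1 : bigoh 1 s t.
  have [P [PO P0 P1]] := sP 2.
  have [C C0 hC] : bigoh 2 t (fun x => s x - c * t x).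
    have PX0 i : (i < 2)%N -> (P - c *: 'X)`_i = 0.
      rewrite coefB coefZ coefX; case: i => [|[|]]//= _.
        by rewrite mulr0 subr0.
      by rewrite mulr1 P1 subrr.
    have := bigohD PO (bigoh_poly_lt t0 PX0); apply: bigoh_near.
    by apply: nearW => x; rewrite hornerD hornerN hornerZ hornerX; ring.
  exists (2 / `|c|); first by rewrite divr_ge0.
  (* Below this threshold the remainder C t^2 is at most half of |c t|, so that |s| >= |c t| / 2 and
     t = O(s). *)
  have e0 : 0 < `|c| / 2 / (C + 1).
    by rewrite !divr_gt0 ?normr_gt0// ltr_wpDl.
  near=> x.
  have te : `|t x| <= `|c| / 2 / (C + 1) by near: x; exact: cvgr0_norm_le.
  have sC : `|s x - c * t x| <= C * `|t x| ^+ 2 by near: x.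
  rewrite expr1 mulrAC ler_pdivlMr ?normr_gt0//.
  have h1 : C * `|t x| ^+ 2 <= `|c| / 2 * `|t x|.
    rewrite expr2 mulrA ler_wpM2r//.
    move: te; rewrite ler_pdivlMr ?ltr_wpDl// => te.
    by rewrite (le_trans _ te)// mulrC ler_wpM2l// lerDl.
  have h2 : `|c * t x| <= `|s x| + `|s x - c * t x|.
    by rewrite -{1}(subKr (s x) (c * t x)) ler_normB.
  rewrite normrM in h2; lra.
have tE : expands 1 s t 0.
  by apply: (bigoh_near _ t1); apply: nearW => x; rewrite horner0 subr0.
case=> [|n]; first by exists 0; rewrite ?coef0//; exact: expands_le tE.
elim: n => [|n [Q tQ Q0]]; first by exists 0; rewrite ?coef0.
have [P [PO P0 P1]] := sP n.+2.
pose B := drop_poly 2 P.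
have PE x : P.[x] = c * x + x ^+ 2 * B.[x].
  by rewrite (poly_dropE 2 P) big_ord_recr big_ord1/= P0 P1 expr1 mul0r add0r.
(* This is t = c^-1 (s - t^2 B(t)) with the current expansion [Q] put for t on the right. The order
   is gained because t^2 - Q(s)^2 = (t - Q(s)) (t + Q(s)) and the last factor is O(s). *)
exists (c^-1 *: ('X - Q ^+ 2 * (B \Po Q))); last first.
  rewrite -horner_coef0 hornerZ hornerD hornerN hornerX hornerM horner_exp.
  by rewrite horner_coef0 Q0 expr0n mul0r subrr mulr0.
have Q1 : bigoh 1 s (fun x => Q.[s x]).
  by apply: bigoh_poly_lt => // i; rewrite ltnS leqn0 => /eqP->.
have Qs0 := bigoh1_cvg s0 Q1.
have O1 : bigoh n.+2 s (fun x => (t x - Q.[s x]) * ((t x + Q.[s x]) * B.[t x])).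
  rewrite -[n.+2]addn1; apply: bigohM => //.
  rewrite -[1%N]addn0; apply: bigohM; first exact: bigohD.
  rewrite -(addn0 0%N); apply: bigoh_trans (bigoh_poly B t0).
  by [].
have O2 : bigoh n.+2 s (fun x => Q.[s x] * Q.[s x] * (B.[t x] - B.[Q.[s x]])).
  rewrite -[n.+2]/(1 + n.+1)%N.
  apply: (@bigoh_le _ (1 + 1 + n.+1)) => //.
  by apply: bigohM; [exact: bigohM|exact: bigoh_lipschitz].
have := bigohZ (- c^-1) (bigohD (bigoh_trans t1 PO) (bigohD O1 O2)).
apply: bigoh_near; apply: nearW => x.
rewrite PE hornerZ hornerD hornerN hornerX hornerM horner_exp horner_comp.
by field.
Unshelve. all: by end_near. Qed.

(** By uniqueness, expansions of different orders agree on their common coefficients, so the i-th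
    one may be read off at order i + 1, the first that determines it. *)
Lemma expands_coef t g : t x @[x --> F] --> (0 : R) ->
  (\forall x \near F, t x != 0) ->
  (forall n, exists P, expands n t g P) ->
  exists c : nat -> R, forall n, expands n t g (\poly_(i < n) c i).
Proof.
move=> t0 t_neq0 /choice[P gP]; exists (fun i => (P i.+1)`_i) => n.
have PO : bigoh n t (fun x => (P n - \poly_(i < n) (P i.+1)`_i).[t x]).
  apply: bigoh_poly_lt => // i iltn; rewrite coefB coef_poly iltn.
  rewrite (@expands_uniq i.+1 t g (P n) (P i.+1))// ?subrr//.
  exact: expands_le (gP n).
apply: (bigoh_near _ (bigohD (gP n) PO)).
by apply: nearW => x; rewrite hornerD hornerN; ring.
Qed.

End big_oh.

(** * Taylor expansions at 0 of the exponential and of real powers *)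

Section taylor_at0.
Context {R : realType}.
Implicit Types (f : R -> R) (P : {poly R}).

Lemma expands_subst {T : Type} (F : set_system T) {FF : ProperFilter F}
    n (t : T -> R) f P : t x @[x --> F] --> (0 : R) ->
  expands (nbhs (0 : R)) n idfun f P -> expands F n t (f \o t) P.
Proof.
by move=> t0 [C C0 hC]; exists C => //; exact: (t0 _ hC).
Qed.

Lemma bigoh_continuous f : {for 0, continuous f} ->
  bigoh (nbhs (0 : R)) 0 idfun f.
Proof.
move=> /cvgrPdist_le f0; exists (`|f 0| + 1); first by rewrite addr_ge0.
near=> x; rewrite expr0 mulr1 -[f x](subKr (f 0)).
rewrite (le_trans (ler_normB _ _))// lerD2l.
by near: x; exact: f0.
Unshelve. all: by end_near. Qed.

Lemma is_derive_poly P (x : R) : is_derive x 1 (horner P) P^`().[x].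
Proof. by apply: DeriveDef; [exact: derivable_horner|rewrite -derive1E derivE]. Qed.

(** The mean value theorem for f - P, which vanishes at 0, multiplies the bound on its derivative by
    |x|. Taylor expansions then follow by induction on the order. *)
Lemma expands_primitive n f f' P :
  (\forall x \near (0 : R), is_derive (x : R) (1 : R) f (f' x)) -> f 0 = P.[0] ->
  expands (nbhs (0 : R)) n idfun f' P^`() ->
  expands (nbhs (0 : R)) n.+1 idfun f P.
Proof.
move=> df f0 [C C0 hC]; exists C => //.
have /nbhs_ballP[e /= e0 he] : \forall x \near (0 : R),
    is_derive (x : R) (1 : R) f (f' x) /\ `|f' x - P^`().[x]| <= C * `|x| ^+ n.
  by near=> x; split; near: x.
near=> x.
have xe : `|x| < e by near: x; exact: (@nbhs0_lt _ R).
have inball (y : R) : `|y| <= `|x| -> ball (0 : R) e y.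
  by move=> yx; rewrite /ball/= sub0r normrN (le_lt_trans yx).
pose g y := f y - P.[y].
pose dg' y := f' y - P^`().[y].
have dg (y : R) : `|y| <= `|x| -> is_derive y 1 g (f' y - P^`().[y]).
  move=> yx; have [dfy _] := he _ (inball _ yx).
  have dP := is_derive_poly P y.
  exact: is_deriveB.
have cg (a b : R) : (forall y, y \in `[a, b] -> `|y| <= `|x|) ->
    {within `[a, b], continuous g}.
  move=> ab; apply: derivable_within_continuous => y yab.
  by have [] := dg y (ab y yab).
have g0 : g 0 = 0 by rewrite /g f0 subrr.
have bound c : `|c| <= `|x| -> `|(f' c - P^`().[c]) * x| <= C * `|x| ^+ n.+1.
  move=> cx; rewrite normrM exprSr mulrA ler_wpM2r//.
  have [_ hc] := he _ (inball _ cx).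
  by rewrite (le_trans hc)// ler_wpM2l// lerXn2r// nnegrE.
have [x0|x0] := leP 0 x.
  have sub y : y \in `[0, x] -> `|y| <= `|x|.
    by rewrite in_itv/= => /andP[y0 yx]; rewrite !ger0_norm.
  have [|c cx] := @MVT_segment _ g dg' _ _ x0 _ (cg _ _ sub).
    by move=> y yx; apply/dg/sub/subset_itv_oo_cc.
  by rewrite g0 !subr0 /g => ->; exact/bound/sub.
have sub y : y \in `[x, 0] -> `|y| <= `|x|.
  by rewrite in_itv/= => /andP[xy y0]; rewrite !ler0_norm ?lerN2// ltW.
have [|c cx] := @MVT_segment _ g dg' _ _ (ltW x0) _ (cg _ _ sub).
  by move=> y yx; apply/dg/sub/subset_itv_oo_cc.
by rewrite g0 !sub0r mulrN => /oppr_inj; rewrite /g => ->; exact/bound/sub.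
Unshelve. all: by end_near. Qed.

Definition exp_poly n : {poly R} := \poly_(i < n) (i`!%:R)^-1.

Lemma expands_expR n : expands (nbhs (0 : R)) n idfun expR (exp_poly n).
Proof.
elim: n => [|n IH].
  rewrite /expands /exp_poly poly_def big_ord0.
  under eq_fun do rewrite horner0 subr0.
  exact/bigoh_continuous/continuous_expR.
apply: (@expands_primitive n expR expR).
- by near=> x; exact: is_derive_expR.
- by rewrite expR0 horner_coef0 coef_poly fact0 invr1.
- suff -> : (exp_poly n.+1)^`() = exp_poly n by [].
  apply/polyP => i; rewrite coef_deriv !coef_poly ltnS.
  case: ifPn => _; last by rewrite mul0rn.
  rewrite factS natrM -[LHS]mulr_natr; field.
  by rewrite nat1r !pnatr_eq0 -lt0n fact_gt0.
Unshelve. all: by end_near. Qed.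

Definition binom_coef (a : R) n := (\prod_(j < n) (a - j%:R)) / n`!%:R.

Definition binom_poly (a : R) n : {poly R} := \poly_(i < n) binom_coef a i.

(** Differentiating the binomial polynomial of exponent a gives a times the one of exponent a - 1,
    so the induction on [n] has to range over all exponents. *)
Lemma expands_powR (a : R) n :
  expands (nbhs (0 : R)) n idfun (fun x => (1 + x) `^ a) (binom_poly a n).
Proof.
have d (b : R) : \forall x \near (0 : R),
    is_derive (x : R) (1 : R) (fun x => (1 + x) `^ b) (b * (1 + x) `^ (b - 1)).
  near=> x.
  have x1 : 0 < 1 + x.
    have : `|x| < 1 by near: x; exact: (@nbhs0_lt _ R).
    by rewrite ltr_norml => /andP[]; lra.
  have dp := is_derive1_powR b x1.
  have d1 : is_derive x (1 : R) (fun x : R => 1 + x) (0 + 1).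
    exact: is_deriveD.
  by have := is_derive1_comp dp d1; rewrite add0r mulr1.
elim: n a => [a|n IH a].
  rewrite /expands /binom_poly poly_def big_ord0.
  under eq_fun do rewrite horner0 subr0.
  apply: bigoh_continuous; apply: differentiable_continuous.
  by apply/derivable1_diffP; have [] := nbhs_singleton (d a).
apply: (expands_primitive (d a)).
  by rewrite addr0 powR1 horner_coef0 coef_poly /binom_coef big_ord0 fact0 divr1.
suff -> : (binom_poly a n.+1)^`() = a *: binom_poly (a - 1) n.
  exact: expandsZ.
apply/polyP => i; rewrite coef_deriv coefZ !coef_poly ltnS.
case: ifPn => _; last by rewrite mul0rn mulr0.
rewrite /binom_coef big_ord_recl/= subr0 factS natrM.
rewrite (eq_bigr (fun j : 'I_i => a - 1 - j%:R)) => [|j _]; last first.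
  by rewrite -addrA -opprD -natr1 [j%:R + 1]addrC.
rewrite -mulr_natr; field.
by rewrite nat1r !pnatr_eq0 -lt0n fact_gt0.
Unshelve. all: by end_near. Qed.

End taylor_at0.

(** * Integrals of powers and exponentials, the Gamma function *)

Section integrals.
Context {R : realType}.
Implicit Types (f G : R -> R).
Local Notation mu := (@lebesgue_measure R).

(** The integrand may blow up at either end, as s^(z - 1) for z < 1 and (1 - t)^(-1/p) do. The
    fundamental theorem is applied on compact subintervals exhausting ]a, b[, and monotone
    convergence gives the limit. *)
Lemma ge0_FTC2_oo f G (a b : R) : a < b ->
  {in `]a, b[, forall x, 0 <= f x} ->
  {in `]a, b[, continuous f} ->
  derivable_oo_LRcontinuous G a b ->
  {in `]a, b[, G^`()%classic =1 f} ->
  (\int[mu]_(x in `]a, b[) (f x)%:E = (G b - G a)%:E)%E.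
Proof.
move=> ab f0 cf [dG Ga Gb] G'f.
(* A third of the length keeps [a + e n, b - e n] nondegenerate already at n = 0. *)
pose e n : R := (b - a) / 3 * n.+1%:R^-1.
have e0 n : 0 < e n by rewrite mulr_gt0// divr_gt0 ?subr_gt0.
have e3 n : e n <= (b - a) / 3.
  by rewrite ger_pMr ?divr_gt0 ?subr_gt0// invf_le1// ler1n.
have abe n : a + e n < b - e n by have := e3 n; lra.
have e_cvg : e n @[n --> \oo] --> (0 : R).
  by rewrite -(mulr0 ((b - a) / 3)); apply: cvgMr; exact: cvg_harmonic.
pose A n : set R := `[a + e n, b - e n]%classic.
have Asub n : A n `<=` `]a, b[%classic.
  move=> x; rewrite /A/= !in_itv/= => /andP[xa xb].
  by have := e0 n => ?; apply/andP; split; lra.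
have AU : \bigcup_n A n = `]a, b[%classic.
  apply/seteqP; split=> [x [n _]|x]; first exact: Asub.
  rewrite /= in_itv/= => /andP[ax xb].
  have d0 : 0 < Num.min (x - a) (b - x) by rewrite lt_min !subr_gt0 ax.
  have [n _ /(_ n (leqnn n))/=] := cvgr0_norm_lt _ e_cvg _ d0.
  rewrite gtr0_norm// lt_min => /andP[h1 h2].
  by exists n => //; rewrite /A/= in_itv/=; apply/andP; split; lra.
have mf : measurable_fun `]a, b[ f.
  apply: open_continuous_measurable_fun; first exact: interval_open.
  by move=> x /[1!inE]; exact: cf.
have ndA : {homo A : n m / (n <= m)%N >-> (n <= m)%O}.
  move=> n m nm; have emn : e m <= e n.
    by rewrite ler_pM2l ?divr_gt0 ?subr_gt0// lef_pV2 ?posrE// ler_nat.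
  by apply/subsetPset; apply: subset_itv; rewrite bnd_simp lerD2l ?lerN2.
have cvgA : (\int[mu]_(x in A n) (f x)%:E)%E @[n --> \oo] -->
    (\int[mu]_(x in `]a, b[) (f x)%:E)%E.
  rewrite -AU; apply: ge0_nondecreasing_set_cvg_integral => //.
  - by move=> i; exact: measurable_itv.
  - by move=> i; apply/measurable_EFinP; apply: measurable_funS mf.
  - by move=> i x /Asub xab; rewrite lee_fin f0.
apply/esym/(cvg_unique _ _ cvgA) => //.
rewrite (_ : (fun i => _) = fun n => (G (b - e n) - G (a + e n))%:E).
  apply: cvg_EFin; first exact: nearW.
  apply: cvgB.
    apply: (cvg_at_leftP G b (G b)).1 => //; split.
      by move=> n; rewrite gtrBl.
    by rewrite -[X in _ --> X]subr0; apply: cvgB => //; exact: cvg_cst.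
  apply: (cvg_at_rightP G a (G a)).1 => //; split.
    by move=> n; rewrite ltrDl.
  by rewrite -[X in _ --> X]addr0; apply: cvgD => //; exact: cvg_cst.
apply/funext => n; rewrite EFinB; apply: continuous_FTC2 => //.
+ apply: continuous_in_subspaceT => x /[1!inE] xA; apply: cf.
  exact: (Asub n).
+ split.
  * by move=> x xA; apply: dG; apply: (Asub n); exact: subset_itv_oo_cc.
  * apply: cvg_at_right_filter; apply: differentiable_continuous.
    apply/derivable1_diffP/dG; apply: (Asub n); rewrite /A/= bound_itvE.
    exact/ltW.
  * apply: cvg_at_left_filter; apply: differentiable_continuous.
    apply/derivable1_diffP/dG; apply: (Asub n); rewrite /A/= bound_itvE.
    exact/ltW.
+ by move=> x xA; apply: G'f; apply: (Asub n); exact: subset_itv_oo_cc.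
Qed.

Lemma integral_expRN_itvoy (q s : R) : 0 < q ->
  (\int[mu]_(r in `]s, +oo[) (q * expR (- (q * r)))%:E =
   (expR (- (q * s)))%:E)%E.
Proof.
move=> q0.
have d (x : R) :
    is_derive x 1 (fun r => - expR (- (q * r))) (q * expR (- (q * x))).
  apply: is_derive_eq.
  by rewrite /GRing.scale/=; ring.
have c0 : continuous (fun r => expR (- (q * r))).
  move=> x; apply: continuous_comp; last exact: continuous_expR.
  by apply: cvgN; apply: cvgMr.
have c : continuous (fun r => q * expR (- (q * r))).
  by move=> x; apply: cvgMr; exact: c0.
rewrite integral_itv_obnd_cbnd; last first.
  apply/measurable_EFinP; apply: measurable_funTS.
  exact: continuous_measurable_fun.
rewrite (@ge0_continuous_FTC2y _ _ (fun r => - expR (- (q * r))) _ 0).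
- by rewrite sub0e EFinN oppeK.
- by move=> x _; rewrite mulr_ge0 ?expR_ge0// ltW.
- exact: continuous_subspaceT.
- rewrite -oppr0; apply: cvgN.
  apply: (cvg_comp _ _ _ (@cvgr_expR R)).
  by apply: gt0_cvgMry.
- by move=> x _; have [] := d x.
- by apply: cvg_at_right_filter; apply: cvgN; exact: c0.
- by move=> x _; rewrite derive1E; have [_ ->] := d x.
Qed.

Lemma fine_itv_oo (y z : R) : y < z -> fine (mu `]y, z[%classic) = z - y.
Proof. by move=> yz; rewrite lebesgue_measure_itv/= lte_fin yz. Qed.

Lemma Rintegral_cst_oo (c y z : R) : y < z ->
  \int[mu]_(t in `]y, z[) c = (z - y) * c.
Proof. by move=> yz; rewrite Rintegral_cst// fine_itv_oo// mulrC. Qed.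

Lemma integrable_cst_oo (c y z : R) : mu.-integrable `]y, z[ (EFin \o cst c).
Proof.
apply/integrableP; split; first by apply/measurable_EFinP; exact: measurable_cst.
rewrite /= integral_cst//= lebesgue_measure_itv/=.
by case: ifP => _; rewrite -?EFinB ?mule0 -?EFinM ltry.
Qed.

End integrals.

(** * Gamma integrals: recursion, change of rate, finiteness *)

Section gamma.
Context {R : realType}.
Implicit Types (f h : R -> R) (z q a : R).
Local Notation mu := (@lebesgue_measure R).

(** Tonelli for f(x) h(r) restricted to [E]. The form with sections serves both the recursion of
    Gamma ([E] a triangle) and the layer cake ([E] the region under a graph). *)
Lemma tonelli_sections f h (E : set (R * R)) :
  measurable_fun setT f -> measurable_fun setT h ->
  (forall x, 0 <= f x) -> (forall x, 0 <= h x) -> measurable E ->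
  (\int[mu]_x ((f x)%:E * \int[mu]_(r in xsection E x) (h r)%:E) =
   \int[mu]_r ((h r)%:E * \int[mu]_(x in ysection E r) (f x)%:E))%E.
Proof.
move=> mf mh f0 h0 mE.
pose K (x : R * R) := (f x.1 * h x.2 * \1_E x)%:E.
have mK : measurable_fun setT K.
  apply/measurable_EFinP; apply: measurable_funM; last exact: measurable_indic.
  by apply: measurable_funM; apply: measurableT_comp.
have K0 (x : R * R) : (0 <= K x)%E by rewrite lee_fin !mulr_ge0.
have : (\int[mu]_x \int[mu]_y K (x, y) = \int[mu]_y \int[mu]_x K (x, y))%E.
  exact: fubini_tonelli.
move=> fub; transitivity (\int[mu]_x \int[mu]_y K (x, y))%E; last first.
  rewrite fub; apply: eq_integral => r _.
  rewrite [in RHS]integral_mkcond -ge0_integralZl_EFin; last 4 first.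
  - exact: measurableT.
  - by move=> x _; apply: erestrict_ge0 => y _; rewrite lee_fin.
  - apply/(measurable_restrictT _ (measurable_ysection r mE)).
    by apply/measurable_EFinP; exact: measurable_funTS.
  - exact: h0.
  apply: eq_integral => x _; rewrite /K/= patchE indicE mem_ysection.
  by case: ifPn => _; rewrite ?mulr1 ?mulr0 ?mule0// mulrC EFinM.
apply: eq_integral => x _.
rewrite [in LHS]integral_mkcond -ge0_integralZl_EFin; last 4 first.
- exact: measurableT.
- by move=> r _; apply: erestrict_ge0 => y _; rewrite lee_fin.
- apply/(measurable_restrictT _ (measurable_xsection x mE)).
  by apply/measurable_EFinP; exact: measurable_funTS.
- exact: f0.
apply: eq_integral => r _; rewrite /K/= patchE indicE mem_xsection.
by case: ifPn => _; rewrite ?mulr1 ?mulr0 ?mule0.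
Qed.

Lemma continuous_powR a (s : R) : 0 < s -> {for s, continuous (@powR R ^~ a)}.
Proof.
move=> s0; apply: differentiable_continuous; apply/derivable1_diffP.
by have [] := is_derive1_powR a s0.
Qed.

Lemma le_powRN a (s t : R) : 0 <= a -> 0 < s -> s <= t -> t `^ (- a) <= s `^ (- a).
Proof.
move=> a0 s0 st; have t0 := lt_le_trans s0 st.
rewrite !powRN lef_pV2 ?posrE ?powR_gt0//.
by apply: ge0_ler_powR; rewrite ?nnegrE// ltW.
Qed.

Lemma integral_powR_itv0o z (t : R) : 0 < z -> 0 < t ->
  (\int[mu]_(s in `]0%R, t[) (z * s `^ (z - 1))%:E = (t `^ z)%:E)%E.
Proof.
move=> z0 t0.
have d (s : R) : 0 < s -> is_derive s 1 (@powR R ^~ z) (z * s `^ (z - 1)).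
  by move=> s0; exact: is_derive1_powR.
rewrite (ge0_FTC2_oo (G := @powR R ^~ z)) ?powR0 ?subr0 ?gt_eqF//.
- by move=> s _; rewrite mulr_ge0 ?powR_ge0// ltW.
- move=> s; rewrite in_itv/= => /andP[s0 _]; apply: cvgMr.
  exact: continuous_powR.
- split.
  + by move=> s; rewrite in_itv/= => /andP[s0 _]; have [] := d s s0.
  + by rewrite powR0 ?gt_eqF//; exact: powR_cvg0.
  + by apply: cvg_at_left_filter; exact: continuous_powR.
- move=> s; rewrite in_itv/= => /andP[s0 _].
  by rewrite derive1E; have [_ ->] := d s s0.
Qed.

(** Extended values allow the recursion and the change of rate to be proved before finiteness. *)
Definition gammae z q : \bar R :=
  (\int[mu]_(r in `]0%R, +oo[) (r `^ (z - 1) * expR (- (q * r)))%:E)%E.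

Lemma measurable_gamma_fun z q (D : set R) :
  measurable_fun D (fun r : R => r `^ (z - 1) * expR (- (q * r))).
Proof.
apply: measurable_funTS; apply: measurable_funM => //.
apply: continuous_measurable_fun => x.
apply: continuous_comp; last exact: continuous_expR.
by apply: cvgN; apply: cvgMr.
Qed.

Lemma GammaE z : Gamma z = fine (gammae z 1).
Proof.
by rewrite /Gamma /Rintegral /gammae; under [in RHS]eq_integral do rewrite mul1r.
Qed.

Lemma gammae_ge0 z q : (0 <= gammae z q)%E.
Proof. by apply: integral_ge0 => r _; rewrite lee_fin mulr_ge0 ?powR_ge0 ?expR_ge0. Qed.

(* Both sides are the integral of [z s^(z-1) e^-r] over [0 < s < r]. *)
Lemma gammaeS z : 0 < z -> gammae (z + 1) 1 = (z%:E * gammae z 1)%E.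
Proof.
move=> z0; pose E : set (R * R) := [set x | 0 < x.1 < x.2].
have mE : measurable E.
  have -> : E = [set x | 0 < x.1] `&` [set x | x.1 < x.2].
    by apply/seteqP; split => x /andP.
  apply: measurableI.
    have : measurable_fun setT (fun x : R * R => 0 < x.1).
      by apply: measurable_fun_ltr => //; exact: measurable_fst.
    by move=> /(_ measurableT [set true]); rewrite setTI; exact.
  have : measurable_fun setT (fun x : R * R => x.1 < x.2).
    by apply: measurable_fun_ltr.
  by move=> /(_ measurableT [set true]); rewrite setTI; exact.
have m1 : measurable_fun setT (fun s : R => z * s `^ (z - 1)).
  by apply: measurable_funM.
have m2 : measurable_fun setT (fun r : R => 1 * expR (- (1 * r))).
  apply: continuous_measurable_fun => x; apply: cvgMr.
  apply: continuous_comp; last exact: continuous_expR.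
  by apply: cvgN; apply: cvgMr.
have := tonelli_sections m1 m2 _ _ mE.
move=> /(_ (fun s => mulr_ge0 (ltW z0) (powR_ge0 _ _))).
move=> /(_ (fun r => mulr_ge0 ler01 (expR_ge0 _))) tE.
rewrite /gammae -ge0_integralZl_EFin//; last 3 first.
- by move=> r _; rewrite lee_fin mulr_ge0 ?powR_ge0 ?expR_ge0.
- by apply/measurable_EFinP; exact: measurable_gamma_fun.
- exact: ltW.
rewrite [LHS]integral_mkcond [RHS]integral_mkcond.
transitivity (\int[mu]_r ((1 * expR (- (1 * r)))%:E *
    \int[mu]_(x in ysection E r) (z * x `^ (z - 1))%:E)%E)%E.
  apply: eq_integral => r _; rewrite patchE mem_setE in_itv/= andbT.
  case: ifPn => [r0|]; last first.
    rewrite -leNgt => r0; rewrite (_ : ysection E r = set0).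
      by rewrite integral_set0 mule0.
    rewrite -subset0 => x /ysectionP/andP[x0 xr].
    by move: (lt_trans x0 xr); rewrite ltNge r0.
  rewrite (_ : ysection E r = `]0, r[%classic) ?integral_powR_itv0o//.
    by rewrite addrK !mul1r -EFinM mulrC.
  apply/seteqP; split => x /=; rewrite in_itv/=; first by move=> /ysectionP.
  by move=> xr; apply/ysectionP.
rewrite -tE; apply: eq_integral => s _; rewrite patchE mem_setE in_itv/= andbT.
case: ifPn => [s0|].
  rewrite (_ : xsection E s = `]s, +oo[%classic).
    by rewrite integral_expRN_itvoy// -!EFinM mulrA.
  apply/seteqP; split => x /=; rewrite in_itv/= andbT.
    by move=> /xsectionP/andP[].
  by move=> sx; apply/xsectionP; rewrite /E/= s0.
rewrite -leNgt => s0; rewrite (_ : xsection E s = set0).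
  by rewrite integral_set0 mule0.
by rewrite -subset0 => x /xsectionP/andP[]; rewrite ltNge s0.
Qed.

Lemma GammaS z : 0 < z -> Gamma (z + 1) = z * Gamma z.
Proof.
move=> z0; rewrite !GammaE gammaeS//; have := gammae_ge0 z 1.
(* Finiteness is not at hand for z < 1. An infinite integral would have [fine] equal to 0 on both
   sides, so the equation holds in that case too. *)
case: (gammae z 1) => [r| |]//= _.
by rewrite mulr0 gt0_muley.
Qed.

(** Substitution of q r for r. With [1 < z] the integrand is continuous up to 0, as the substitution
    theorem asks; the arguments needed later have the form a + 1 with a > 0. *)
Lemma gammae_scale z q : 1 < z -> 0 < q ->
  gammae z q = ((q `^ (- z))%:E * gammae z 1)%E.
Proof.
move=> z1 q0; pose G (r : R) := r `^ (z - 1) * expR (- (1 * r)).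
have dq (x : R) : is_derive x 1 ( *%R q) q.
  by apply: is_derive_eq; rewrite /GRing.scale/= mulr1.
have dqE : (fun x : R => q * x)^`()%classic = cst q.
  by apply/funext => x; rewrite derive1E; have [_ ->] := dq x.
have cE : continuous (fun r : R => expR (- (1 * r))).
  move=> x; apply: continuous_comp; last exact: continuous_expR.
  by apply: cvgN; apply: cvgMr.
have G0 r : 0 <= G r by rewrite mulr_ge0 ?powR_ge0 ?expR_ge0.
have -> : gammae z 1 = (\int[mu]_(r in `[(q * 0)%R, +oo[) (G r)%:E)%E.
  rewrite mulr0 -integral_itv_obnd_cbnd//.
  by apply/measurable_EFinP; exact: measurable_gamma_fun.
rewrite (increasing_ge0_integration_by_substitutiony (F := *%R q)).
- rewrite /gammae integral_itv_obnd_cbnd; last first.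
    by apply/measurable_EFinP; exact: measurable_gamma_fun.
  rewrite -ge0_integralZl_EFin ?powR_ge0//; last 2 first.
  + by move=> x _; rewrite lee_fin dqE mulr_ge0//= ltW.
  + apply/measurable_EFinP; rewrite dqE; apply: measurable_funTS.
    apply: measurable_funM => //; apply: measurableT_comp => //.
    exact: measurable_gamma_fun.
  apply: eq_integral => x; rewrite inE/= in_itv/= andbT => x0.
  rewrite -EFinM; congr EFin; rewrite dqE.
  rewrite -[((G \o _) * _) x]/((q * x) `^ (z - 1) * expR (- (1 * (q * x))) * q).
  rewrite powRM ?(ltW q0) ?(ltW x0)// mul1r.
  have -> : q `^ (- z) = (q `^ (z - 1) * q)^-1.
    rewrite powRN; congr _^-1.
    by rewrite mulrC mulr_powRB1 ?(ltW q0)// (lt_trans _ z1).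
  by field; rewrite ?gt_eqF ?powR_gt0.
- by move=> x y _ _ xy; rewrite ltr_pM2l.
- by rewrite dqE => x _; exact: cvg_cst.
- by rewrite dqE; exact: is_cvg_cst.
- by rewrite dqE; exact: is_cvg_cst.
- split; first by move=> x _; have [] := dq x.
  by apply: cvg_at_right_filter; apply: cvgMr.
- exact: gt0_cvgMry.
- rewrite mulr0; apply/continuous_within_itvcyP; split.
    move=> x; rewrite in_itv/= andbT => x0; apply: cvgM; last exact: cE.
    exact: continuous_powR.
  rewrite /G; apply: cvgM; last by apply: cvg_at_right_filter; exact: cE.
  by rewrite powR0 ?subr_eq0 ?gt_eqF//; apply: powR_cvg0; rewrite subr_gt0.
- by move=> x _; exact: G0.
Qed.

Lemma powR_le_expR a : 0 <= a ->
  exists2 C : R, 0 <= C & forall r, 0 < r -> r `^ a <= C * expR (r / 2).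
Proof.
move=> a0; pose n := Num.truncn a.
(* For r > 1 a single term of the exponential series suffices, (r/2)^(n+1) / (n+1)! <= e^(r/2); the
   summand 1 covers r <= 1, where r^a <= 1. *)
exists (2 ^+ n.+1 * n.+1`!%:R + 1).
  by rewrite addr_ge0// mulr_ge0.
move=> r r0; rewrite mulrDl mul1r.
have r20 : 0 <= r / 2 by rewrite divr_ge0// ltW.
have [r1|r1] := leP r 1.
  rewrite (@le_trans _ _ 1)//.
    by rewrite -(powRr0 r) ger_powR// r0.
  apply: ler_wpDl; first by rewrite !mulr_ge0 ?expR_ge0 ?exprn_ge0.
  by rewrite -[leLHS]expR0 ler_expR.
apply: ler_wpDr; rewrite ?expR_ge0// (@le_trans _ _ (r ^+ n.+1))//.
  rewrite -powR_mulrn ?(ltW r0)//; apply: ler_powR; first exact: ltW.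
  exact/ltW/truncnS_gt.
have := expR_ge1Dxn n r20; rewrite expr_div_n => h.
have : 2 ^+ n.+1 * n.+1`!%:R * (r ^+ n.+1 / 2 ^+ n.+1 / n.+1`!%:R) <=
   2 ^+ n.+1 * n.+1`!%:R * expR (r / 2).
  by rewrite ler_wpM2l ?mulr_ge0//; lra.
congr (_ <= _); field.
by rewrite expf_neq0//= pnatr_eq0 -lt0n fact_gt0.
Qed.

(** One half of the exponent in e^-r absorbs the power r^(z - 1); the other half remains
    integrable. *)
Lemma gammae_fin_num z : 1 <= z -> gammae z 1 \is a fin_num.
Proof.
move=> z1; have [|C C0 hC] := @powR_le_expR (z - 1); first by rewrite subr_ge0.
rewrite ge0_fin_numE ?gammae_ge0//.
apply: (@le_lt_trans _ _
  (\int[mu]_(r in `]0%R, +oo[) ((2 * C)%:E * (2^-1 * expR (- (2^-1 * r)))%:E))%E).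
  apply: ge0_le_integral => //.
  - by move=> r _; rewrite lee_fin mulr_ge0 ?powR_ge0 ?expR_ge0.
  - by apply/measurable_EFinP; exact: measurable_gamma_fun.
  - apply/measurable_EFinP; apply: measurable_funTS.
    apply: continuous_measurable_fun => x; apply: cvgMr; apply: cvgMr.
    apply: continuous_comp; last exact: continuous_expR.
    by apply: cvgN; apply: cvgMr.
  - move=> r; rewrite /= in_itv/= andbT => r0; rewrite -EFinM lee_fin.
    have -> : 2 * C * (2^-1 * expR (- (2^-1 * r))) =
        C * expR (r / 2) * expR (- (1 * r)).
      by rewrite -[RHS]mulrA -expRD (_ : r / 2 + - (1 * r) = - (2^-1 * r)); field.
    by rewrite ler_wpM2r ?expR_ge0// hC.
rewrite ge0_integralZl_EFin; last 4 first.
- exact: measurable_itv.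
- by move=> r _; rewrite lee_fin mulr_ge0 ?expR_ge0.
- apply/measurable_EFinP; apply: measurable_funTS.
  apply: continuous_measurable_fun => x; apply: cvgMr.
  apply: continuous_comp; last exact: continuous_expR.
  by apply: cvgN; apply: cvgMr.
- by rewrite mulr_ge0.
by rewrite integral_expRN_itvoy ?invr_gt0// ltry.
Qed.

Lemma gammae_Gamma z q : 1 < z -> 0 < q ->
  gammae z q = (Gamma z * q `^ (- z))%:E.
Proof.
move=> z1 q0; rewrite gammae_scale// GammaE EFinM fineK ?gammae_fin_num ?ltW//.
by rewrite muleC.
Qed.

Lemma Gamma_ge0 z : 0 <= Gamma z.
Proof. by rewrite GammaE fine_ge0// gammae_ge0. Qed.

End gamma.

(** * Watson's lemma and layer cake *)

Section watson.
Context {R : realType}.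
Implicit Types (m : R -> R) (q a : R) (c : nat -> R).
Local Notation mu := (@lebesgue_measure R).

(** A factor e^r is the price for making the estimate near 0 global: away from 0 it dominates [m] by
    hypothesis, and the finite sum is itself O(r^(n + a)) there. *)
Lemma bound_expR m a c n : 0 < a ->
  (forall r, 0 < r -> 0 <= m r <= expR r) ->
  (exists C : R, \forall r \near 0^'+,
    `|m r - r `^ a * \sum_(j < n) c j * r ^+ j| <= C * r `^ (n%:R + a)) ->
  exists2 D : R, 0 <= D & forall r, 0 < r ->
    `|m r - r `^ a * \sum_(j < n) c j * r ^+ j| <=
    D * r `^ (n%:R + a) * expR r.
Proof.
move=> a0 m0 [C [d /= d0 hd]].
(* For d <= r and j < n one has r^j <= r^n / d^(n - j), which yields [B]. *)
pose B := \sum_(j < n) `|c j| / d ^+ (n - j).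
have B0 : 0 <= B by apply: sumr_ge0 => j _; rewrite divr_ge0// exprn_ge0// ltW.
pose na := n%:R + a.
exists (`|C| + ((d `^ na)^-1 + B)).
  by rewrite !addr_ge0// invr_ge0 powR_ge0.
move=> r r0; have e1 : 1 <= expR r by rewrite -[leLHS]expR0 ler_expR ltW.
have [rd|rd] := ltP r d.
  apply: (@le_trans _ _ (`|C| * r `^ na)).
    have rball : ball_ Num.norm (0 : R) d r.
      by rewrite /ball_/= sub0r normrN gtr0_norm.
    rewrite (le_trans (hd r rball r0))//.
    by rewrite ler_wpM2r ?powR_ge0// ler_norm.
  rewrite -mulrA ler_pM ?mulr_ge0 ?powR_ge0//.
    by rewrite lerDl addr_ge0// invr_ge0 powR_ge0.
  by rewrite ler_peMr ?powR_ge0.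
have mE : `|m r| <= (d `^ na)^-1 * r `^ na * expR r.
  have /andP[m1 m2] := m0 _ r0; rewrite ger0_norm// (le_trans m2)//.
  rewrite ler_peMl ?expR_ge0// mulrC ler_pdivlMr ?powR_gt0// mul1r.
  by apply: ge0_ler_powR; rewrite ?nnegrE ?addr_ge0// ltW.
have sE : `|r `^ a * \sum_(j < n) c j * r ^+ j| <= B * r `^ na * expR r.
  have -> : r `^ na = r `^ a * r ^+ n.
    by rewrite /na addrC powRD ?powR_mulrn ?(ltW r0)// (gt_eqF r0) implybT.
  rewrite normrM (ger0_norm (powR_ge0 _ _)) mulrCA -mulrA.
  rewrite ler_wpM2l ?powR_ge0// (@le_trans _ _ (B * r ^+ n))//; last first.
    by rewrite ler_peMr// mulr_ge0// exprn_ge0// ltW.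
  rewrite (le_trans (ler_norm_sum _ _ _))// mulr_suml ler_sum// => j _.
  rewrite normrM normrX (gtr0_norm r0) -mulrA ler_wpM2l//.
  rewrite mulrC ler_pdivlMr ?exprn_gt0//.
  have -> : r ^+ n = r ^+ j * r ^+ (n - j) by rewrite -exprD subnKC// ltnW.
  rewrite ler_wpM2l ?exprn_ge0 ?(ltW r0)//.
  by rewrite lerXn2r// ?nnegrE ltW.
rewrite (le_trans (ler_normB _ _))// (le_trans (lerD mE sE))//.
by rewrite -!mulrDl !ler_wpM2r ?expR_ge0 ?powR_ge0// lerDr.
Qed.

Lemma integrable_gamma_fun q a : 0 < q -> 0 < a ->
  mu.-integrable `]0, +oo[
    (EFin \o (fun r : R => r `^ a * expR (- (q * r)))).
Proof.
move=> q0 a0; have aE : a = a + 1 - 1 by rewrite addrK.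
apply/integrableP; split.
  by apply/measurable_EFinP; rewrite aE; exact: measurable_gamma_fun.
apply: (@le_lt_trans _ _ (gammae (a + 1) q)); last first.
  by rewrite gammae_Gamma ?ltry// ltrDr.
rewrite le_eqVlt; apply/orP; left; apply/eqP; apply: eq_integral => r _.
by rewrite -aE/= ger0_norm// mulr_ge0 ?powR_ge0 ?expR_ge0.
Qed.

Lemma Rintegral_gamma_fun q a : 0 < q -> 0 < a ->
  \int[mu]_(r in `]0, +oo[) (r `^ a * expR (- (q * r))) =
  Gamma (a + 1) * q `^ (- (a + 1)).
Proof.
move=> q0 a0; rewrite /Rintegral.
have := @gammae_Gamma R (a + 1) q; rewrite /gammae addrK => -> //.
by rewrite ltrDr.
Qed.

Lemma integrable_sum_gamma_fun q a c n : 0 < q -> 0 < a ->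
  mu.-integrable `]0, +oo[ (EFin \o (fun r : R =>
     r `^ a * (\sum_(j < n) c j * r ^+ j) * expR (- (q * r)))) /\
  \int[mu]_(r in `]0, +oo[)
     (r `^ a * (\sum_(j < n) c j * r ^+ j) * expR (- (q * r))) =
  \sum_(j < n) c j * (Gamma (j%:R + a + 1) * q `^ (- (j%:R + a + 1))).
Proof.
move=> q0 a0; elim: n => [|n [IH1 IH2]].
  have -> : (fun r : R => r `^ a * (\sum_(j < 0) c j * r ^+ j) *
      expR (- (q * r))) = cst 0.
    by apply/funext => r; rewrite big_ord0 mulr0 mul0r.
  split; first exact: integrable0.
  by rewrite big_ord0 /Rintegral integral0.
have na0 : 0 < n%:R + a by rewrite ltr_wpDl.
pose f r := r `^ a * (\sum_(j < n) c j * r ^+ j) * expR (- (q * r)).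
pose g r := c n * (r `^ (n%:R + a) * expR (- (q * r))).
have gI : mu.-integrable `]0, +oo[ (EFin \o g).
  rewrite (_ : EFin \o g = (fun r : R =>
    (c n)%:E * (r `^ (n%:R + a) * expR (- (q * r)))%:E)%E); last first.
    by apply/funext => r /=; rewrite EFinM.
  by apply: integrableZl => //; exact: integrable_gamma_fun.
have fgE r : r \in `]0, +oo[%classic -> 
    r `^ a * (\sum_(j < n.+1) c j * r ^+ j) * expR (- (q * r)) = f r + g r.
  rewrite inE/= in_itv/= andbT => r0; rewrite /f /g big_ord_recr/=.
  rewrite [n%:R + a]addrC powRD ?powR_mulrn ?(ltW r0)//; first by ring.
  by rewrite (gt_eqF r0) implybT.
split.
  have : mu.-integrable `]0, +oo[ ((EFin \o f) \+ (EFin \o g))%E.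
    exact: integrableD.
  by apply: eq_integrable => // r r0; rewrite /= fgE// EFinD.
transitivity (\int[mu]_(r in `]0, +oo[) (f r + g r)); first exact: eq_Rintegral.
rewrite RintegralD// big_ord_recr/= -IH2; congr (_ + _).
by rewrite RintegralZl// ?Rintegral_gamma_fun//; exact: integrable_gamma_fun.
Qed.

(** Each r^(j + a) integrates against e^(-q r) to Gamma(j + a + 1) q^-(j + a + 1), and the factors
    q^a and q turn this into q^-j. The e^r in the remainder bound changes the rate to q - 1. *)
Lemma watson m a c : 0 < a -> measurable_fun (`]0, +oo[%classic : set R) m ->
  (forall r, 0 < r -> 0 <= m r <= expR r) ->
  (forall n, exists C : R, \forall r \near 0^'+,
    `|m r - r `^ a * \sum_(j < n) c j * r ^+ j| <= C * r `^ (n%:R + a)) ->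
  asymptotic_expansion
    (fun q => q `^ a *
      \int[mu]_(r in `]0, +oo[) (q * (m r * expR (- (q * r)))))
    (fun j => c j * Gamma (j%:R + a + 1)).
Proof.
move=> a0 mm m0 mc N.
(* The terms j <= N number N + 1, so the remainder is O(r^(N + 1 + a)); after division by q^-N a
   factor 1/q is left. *)
have [D D0 hD] := bound_expR a0 m0 (mc N.+1).
pose na := N.+1%:R + a.
have na0 : 0 < na by rewrite ltr_wpDl.
(* The power of 2 comes from q - 1 >= q / 2, valid for q > 2. *)
pose K := D * Gamma (na + 1) * 2 `^ (na + 1).
have K0 : 0 <= K by rewrite !mulr_ge0 ?Gamma_ge0 ?powR_ge0.
suff bd q : 2 < q -> `|(q `^ a *
      \int[mu]_(r in `]0, +oo[) (q * (m r * expR (- (q * r)))) -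
    \sum_(j < N.+1) c j * Gamma (j%:R + a + 1) / q ^+ j) / q ^- N| <= K / q.
  apply/cvgr0Pnorm_le => e e0; near=> q.
  have q2 : 2 < q by near: q; apply: nbhs_pinfty_gt; exact: num_real.
  have Kq : K / e <= q by near: q; apply: nbhs_pinfty_ge; exact: num_real.
  rewrite (le_trans (bd q q2))// ler_pdivrMr ?(lt_trans _ q2)//.
  by rewrite mulrC -ler_pdivrMr.
move=> q2; have q0 : 0 < q by rewrite (lt_trans _ q2).
have q1 : 0 < q - 1 by rewrite subr_gt0 (lt_trans _ q2)// ltr1n.
pose P r := \sum_(j < N.+1) c j * r ^+ j.
have [PI PE] := @integrable_sum_gamma_fun q a c N.+1 q0 a0.
have mexp (k : R) : measurable_fun (`]0, +oo[%classic : set R)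
    (fun r : R => expR (- (k * r))).
  apply: measurable_funTS; apply: continuous_measurable_fun => x.
  apply: continuous_comp; last exact: continuous_expR.
  by apply: cvgN; apply: cvgMr.
have expI : mu.-integrable `]0, +oo[
    (EFin \o (fun r : R => expR (- ((q - 1) * r)))).
  have int1 := integral_expRN_itvoy 0 q1.
  apply/integrableP; split; first by apply/measurable_EFinP; exact: mexp.
  apply: (@le_lt_trans _ _ (\int[mu]_(r in `]0%R, +oo[)
    ((q - 1) * expR (- ((q - 1) * r)))%:E)%E); last by rewrite int1 ltry.
  apply: ge0_le_integral => //.
  - by apply: measurableT_comp => //; apply/measurable_EFinP; exact: mexp.
  - by apply/measurable_EFinP; apply: measurable_funM => //; exact: mexp.
  - move=> r _; rewrite /= lee_fin ger0_norm ?expR_ge0//.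
    by rewrite ler_peMl ?expR_ge0//; lra.
have mI : mu.-integrable `]0, +oo[ (EFin \o (fun r => m r * expR (- (q * r)))).
  move: expI; apply: le_integrable => //.
  - by apply/measurable_EFinP; apply: measurable_funM => //; exact: mexp.
  - move=> r; rewrite /= in_itv/= andbT => r0; have /andP[m1 m2] := m0 r r0.
    rewrite lee_fin !ger0_norm ?mulr_ge0 ?expR_ge0//.
    rewrite (_ : - ((q - 1) * r) = r + - (q * r)); last by ring.
    by rewrite expRD ler_wpM2r ?expR_ge0.
rewrite RintegralZl//.
have sumE : \sum_(j < N.+1) c j * Gamma (j%:R + a + 1) / q ^+ j =
    q `^ a * (q * \int[mu]_(r in `]0, +oo[)
      (r `^ a * P r * expR (- (q * r)))).
  rewrite PE !mulr_sumr; apply: eq_bigr => j _.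
  rewrite opprD powRD ?(gt_eqF q0) ?implybT//.
  rewrite opprD powRD ?(gt_eqF q0) ?implybT//.
  rewrite !powRN powRr1 ?(ltW q0)// powR_mulrn ?(ltW q0)//.
  by field; rewrite ?expf_neq0 ?gt_eqF ?powR_gt0.
rewrite sumE -mulrBr -mulrBr -RintegralB//.
pose E r := (m r - r `^ a * P r) * expR (- (q * r)).
have EE : (fun r => m r * expR (- (q * r)) - r `^ a * P r * expR (- (q * r))) = E.
  by apply/funext => r; rewrite /E mulrBl.
under eq_Rintegral do rewrite -mulrBl.
have EI : mu.-integrable `]0, +oo[ (EFin \o E).
  rewrite -EE (_ : EFin \o _ = (fun r => (m r * expR (- (q * r)))%:E -
    (r `^ a * P r * expR (- (q * r)))%:E)%E); last by apply/funext => r /=; rewrite EFinB.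
  exact: integrableB.
have gI := integrable_gamma_fun q1 na0.
have Ebound : `|\int[mu]_(r in `]0, +oo[) E r| <=
    D * (Gamma (na + 1) * (q - 1) `^ (- (na + 1))).
  rewrite -Rintegral_gamma_fun// -RintegralZl//.
  apply: (le_trans (le_normr_Rintegral _ EI)) => //.
  apply: le_Rintegral => //.
  - exact: (integrable_norm EI).
  - rewrite (_ : EFin \o _ = (fun r : R => D%:E *
      (r `^ na * expR (- ((q - 1) * r)))%:E)%E); last first.
      by apply/funext => r /=; rewrite EFinM.
    exact: integrableZl.
  - move=> r; rewrite /= in_itv/= andbT => r0.
    rewrite /E normrM (ger0_norm (expR_ge0 _)).
    rewrite (_ : - ((q - 1) * r) = r + - (q * r)); last by ring.
    by rewrite expRD !mulrA ler_wpM2r ?expR_ge0// hD.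
rewrite !normrM invrK normrX (gtr0_norm q0) (ger0_norm (powR_ge0 _ _)).
have qh : (q - 1) `^ (- (na + 1)) <= 2 `^ (na + 1) * q `^ (- (na + 1)).
  rewrite !powRN ler_pdivlMr ?powR_gt0// mulrC ler_pdivrMr ?powR_gt0//.
  rewrite -powRM ?(ltW q1)//.
  by apply: ge0_ler_powR; rewrite ?nnegrE; lra.
apply: (@le_trans _ _ (q `^ a * (q *
    (D * (Gamma (na + 1) * (2 `^ (na + 1) * q `^ (- (na + 1)))))) * q ^+ N)).
  rewrite ler_wpM2r ?exprn_ge0 ?(ltW q0)// ler_wpM2l ?powR_ge0//.
  rewrite ler_wpM2l ?(ltW q0)// (le_trans Ebound)// ler_wpM2l//.
  by rewrite ler_wpM2l ?Gamma_ge0.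
have qna : q `^ (- (na + 1)) = (q `^ a * q ^+ N.+2)^-1.
  rewrite powRN -powR_mulrn ?(ltW q0)// -powRD ?(gt_eqF q0) ?implybT//.
  by congr (_ `^ _)^-1; rewrite /na -[N.+2%:R]natr1; ring.
rewrite le_eqVlt; apply/orP; left; apply/eqP; rewrite /K qna !exprS.
by field; rewrite ?expf_neq0 ?gt_eqF ?powR_gt0.
Unshelve. all: by end_near. Qed.

End watson.

(** * Layer cake with logarithmic levels *)

Section layer_cake.
Context {R : realType}.
Implicit Types (g : R -> R) (q r x : R).
Local Notation mu := (@lebesgue_measure R).

(** Writing the level as e^-r makes the layer-cake formula a Laplace transform in q. *)
Definition level_set g r : set R := [set x | 0 < x /\ expR (- r) < g x].

Let region g : set (R * R) :=
  [set z | [/\ 0 < z.1, 0 < z.2 & expR (- z.2) < g z.1]].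

Let measurable_region g : measurable_fun setT g -> measurable (region g).
Proof.
move=> mg.
have -> : region g = ([set z | 0 < z.1] `&` [set z | 0 < z.2]) `&`
    [set z | expR (- z.2) < g z.1].
  by apply/seteqP; split => z /= => [[]|[[]]].
have mset (u v : R * R -> R) : measurable_fun setT u -> measurable_fun setT v ->
    measurable [set z | u z < v z].
  move=> mu mv; have := measurable_fun_ltr mu mv.
  by move=> /(_ measurableT [set true]); rewrite setTI; exact.
apply: measurableI; first apply: measurableI.
- by apply: mset => //; exact: measurable_fst.
- by apply: mset => //; exact: measurable_snd.
- apply: mset; last by apply: measurableT_comp.
  apply: (measurableT_comp (f := fun r => expR (- r))) => //.
  apply: continuous_measurable_fun => x.
  by apply: continuous_comp; [exact: cvgN|exact: continuous_expR].
Qed.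

Let ysection_region g r : 0 < r -> ysection (region g) r = level_set g r.
Proof.
move=> r0; apply/seteqP; split => x; first by move=> /ysectionP[].
by move=> [x0 xr]; apply/ysectionP; split.
Qed.

Lemma measurable_level_set g r : measurable_fun setT g ->
  0 < r -> measurable (level_set g r).
Proof.
move=> mg r0; rewrite -ysection_region//.
by apply: measurable_ysection; exact: measurable_region.
Qed.

Definition level_measure g r : R := fine (mu (level_set g r)).

(** If e^-r < g x then x e^-r < x g x <= 1, so the level set lies in ]0, e^r[. *)
Lemma level_measure_bound g r : measurable_fun setT g ->
  (forall x, 0 < x -> x * g x <= 1) -> 0 < r ->
  mu (level_set g r) = (level_measure g r)%:E /\
  0 <= level_measure g r <= expR r.
Proof.
move=> mg g1 r0.
have le : (mu (level_set g r) <= (expR r)%:E)%E.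
  apply: (@le_trans _ _ (mu (`]0%R, expR r[%classic))).
    apply: le_measure; rewrite ?inE//; first exact: measurable_level_set.
    move=> x [x0 xr]; rewrite /= in_itv/= x0/= -(invrK (expR r)) -expRN.
    rewrite -div1r ltr_pdivlMr ?expR_gt0//.
    by rewrite (lt_le_trans _ (g1 _ x0))// ltr_pM2l.
  by rewrite lebesgue_measure_itv/= lte_fin expR_gt0 sube0.
have fin : mu (level_set g r) \is a fin_num.
  by rewrite ge0_fin_numE// (le_lt_trans le)// ltry.
rewrite /level_measure fineK//; split => //.
by rewrite fine_ge0//= -lee_fin fineK.
Qed.

Lemma measurable_level_measure g : measurable_fun setT g ->
  measurable_fun (`]0, +oo[%classic : set R) (level_measure g).
Proof.
move=> mg.
apply: (@eq_measurable_fun _ _ _ _ _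
    (fun r => fine (mu (ysection (region g) r)))).
  by move=> r; rewrite inE/= in_itv/= andbT => r0; rewrite ysection_region.
apply: measurable_funTS; apply: measurableT_comp => //.
by apply: measurable_fun_ysection; exact: measurable_region.
Qed.

(** For 0 < g x <= 1, (g x)^q is the integral of q e^(-q r) over r > - ln (g x), a half-line inside
    [0, +oo[; the rest is Tonelli. *)
Lemma layer_cake g q : measurable_fun setT g -> 0 < q ->
  (forall x, 0 < x -> 0 <= g x <= 1) ->
  (forall x, 0 < x -> x * g x <= 1) ->
  \int[mu]_(x in `]0, +oo[) g x `^ q =
  \int[mu]_(r in `]0, +oo[) (q * (level_measure g r * expR (- (q * r)))).
Proof.
move=> mg q0 g01 g1; rewrite /Rintegral; congr fine.
have mh : measurable_fun setT (fun r => q * expR (- (q * r))).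
  apply: continuous_measurable_fun => x; apply: cvgMr.
  apply: continuous_comp; last exact: continuous_expR.
  by apply: cvgN; apply: cvgMr.
have h0 r : 0 <= q * expR (- (q * r)) by rewrite mulr_ge0 ?expR_ge0// ltW.
have mone : measurable_fun setT (fun _ : R => 1 : R) by exact: measurable_cst.
have tE := tonelli_sections mone mh (fun=> ler01) h0 (measurable_region mg).
rewrite [LHS]integral_mkcond [RHS]integral_mkcond.
transitivity (\int[mu]_x (1%:E * \int[mu]_(r in xsection (region g) x)
    (q * expR (- (q * r)))%:E))%E.
  apply: eq_integral => x _; rewrite mul1e patchE mem_setE in_itv/= andbT.
  case: ifPn => [x0|x0]; last first.
    rewrite (_ : xsection _ x = set0) ?integral_set0// -subset0 => r.
    by move=> /xsectionP[/= x1]; rewrite x1 in x0.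
  have /andP[gx0 gx1] := g01 _ x0.
  (* The value 0 is treated apart: [ln 0] is 0 by convention, whereas the section is empty. *)
  have [gx|gx] := eqVneq (g x) 0.
    rewrite gx powR0 ?gt_eqF// (_ : xsection _ x = set0) ?integral_set0//.
    rewrite -subset0 => r /xsectionP[/= _ _].
    by rewrite gx ltNge expR_ge0.
  have gxp : 0 < g x by rewrite lt_neqAle eq_sym gx.
  rewrite (_ : xsection _ x = `](- ln (g x))%R, +oo[%classic).
    rewrite integral_expRN_itvoy//; congr EFin.
    by rewrite /powR (negPf gx) mulrN opprK.
  apply/seteqP; split => r /=; rewrite in_itv/= andbT.
    by move=> /xsectionP[/= _ _ gr]; rewrite ltrNl -ltr_expR lnK.
  move=> gr; apply/xsectionP; split => //=.
    by rewrite (le_lt_trans _ gr)// oppr_ge0 ln_le0.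
  by rewrite -(lnK gxp) ltr_expR ltrNl.
rewrite tE; apply: eq_integral => r _; rewrite patchE mem_setE in_itv/= andbT.
case: ifPn => [r0|r0]; last first.
  rewrite (_ : ysection _ r = set0) ?integral_set0 ?mule0// -subset0 => x.
  by move=> /ysectionP[/= _ r1]; rewrite r1 in r0.
have [mE _] := level_measure_bound mg g1 r0.
rewrite ysection_region// integral_cst ?mul1e; last exact: measurable_level_set.
by rewrite [X in (_ * X)%E]mE -EFinM; congr EFin; ring.
Qed.

End layer_cake.

(** * The generalised sine *)

(** This makes [arc_sinp] vanish outside [0, F 1], so that its bounds and measurability hold on the
    whole line and need no control of the reduced argument in [sinp]. *)
Lemma pinv_dflt (T U : Type) (dflt : U -> T) (A : set T) (f : T -> U) (y : U) :
  ~ (f @` A) y -> 'pinv_dflt A f y = dflt y.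
Proof.
move=> nAy; rewrite /pinv_ splitV.
rewrite (_ : 'oinv_[fun f in A] y = None)//.
rewrite -[LHS]/('oinv_((fun _ => id) : set_surj A (f @` A) f) y).
by rewrite oinv_surj; case: pselect.
Qed.

Section Fp.
Context {R : realType} (p : R) (hp : 1 < p).
Implicit Types (x y z t : R).
Local Notation mu := (@lebesgue_measure R).
Local Notation F := (Fp p).

Let p0 : 0 < p. Proof. by rewrite (lt_trans _ hp). Qed.

Definition Fp_fun t := (1 - t `^ p) `^ (- p^-1).
Local Notation f := Fp_fun.

Lemma measurable_Fp_fun (D : set R) : measurable_fun D f.
Proof.
apply: measurable_funTS; apply: (measurableT_comp (measurable_powR _)).
by apply: measurable_funB.
Qed.

Lemma Fp_fun_ge0 t : 0 <= f t.
Proof. exact: powR_ge0. Qed.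

Lemma powR_lt1 t : 0 <= t < 1 -> 0 <= t `^ p < 1.
Proof.
move=> /andP[t0 t1]; have h : 1 = 1 `^ p :> R by rewrite powR1.
by rewrite powR_ge0/= [ltRHS]h; apply: gt0_ltr_powR; rewrite ?nnegrE.
Qed.

Lemma Fp_fun0 : f 0 = 1.
Proof. by rewrite /f powR0 ?gt_eqF// subr0 powR1. Qed.

Lemma le_Fp_fun s t : 0 <= s -> s <= t -> t < 1 -> f s <= f t.
Proof.
move=> s0 st t1; have t0 := le_trans s0 st.
apply: le_powRN; first by rewrite invr_ge0 ltW.
  by rewrite subr_gt0; have /powR_lt1/andP[] : 0 <= t < 1 by rewrite t0.
by rewrite lerD2l lerN2; apply: ge0_ler_powR; rewrite ?nnegrE// ltW.
Qed.

Lemma lt_Fp_fun s t : 0 <= s -> s < t -> t < 1 -> f s < f t.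
Proof.
move=> s0 st t1; have t0 := le_lt_trans s0 st.
have tp : 0 < 1 - t `^ p.
  by rewrite subr_gt0; have /powR_lt1/andP[] : 0 <= t < 1 by rewrite ltW.
have stp : 1 - t `^ p < 1 - s `^ p.
  by rewrite ltrD2l ltrN2; apply: gt0_ltr_powR; rewrite ?nnegrE// ltW.
have sp := lt_trans tp stp.
rewrite /f !powRN ltf_pV2 ?posrE ?powR_gt0//.
by apply: gt0_ltr_powR; rewrite ?nnegrE ?invr_gt0// ltW.
Qed.

Lemma Fp_fun_ge1 t : 0 <= t -> t < 1 -> 1 <= f t.
Proof. by move=> t0 t1; rewrite -Fp_fun0 le_Fp_fun. Qed.

(* [1 - t^p >= 1 - t], and [(1 - t)^(-1/p)] is integrable because [1/p < 1]. *)
Lemma integrable_Fp_fun : mu.-integrable `[0, 1] (EFin \o f).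
Proof.
pose b := 1 - p^-1.
have b0 : 0 < b by rewrite subr_gt0 invf_lt1.
pose h t := (1 - t) `^ (b - 1).
have h0 t : 0 <= h t by exact: powR_ge0.
have dh t : t < 1 -> is_derive t (1 : R) (fun t => - b^-1 * (1 - t) `^ b) (h t).
  move=> t1; have t10 : 0 < 1 - t by rewrite subr_gt0.
  have dp := is_derive1_powR b t10.
  have d1 : is_derive t (1 : R) (fun x : R => 1 - x) (0 - 1).
    exact: is_deriveB.
  have := @is_derive1_comp _ (@powR R ^~ b) (fun x => 1 - x) t _ _ dp d1.
  rewrite sub0r mulrN1 => dc.
  have := @is_deriveZ _ _ _ _ (- b^-1) _ _ _ dc.
  rewrite (_ : - b^-1 *: _ = h t)//.
  by rewrite /GRing.scale/= mulNr mulrN opprK mulrA mulVf ?mul1r// gt_eqF.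
have intE : (\int[mu]_(t in `]0%R, 1%R[) (h t)%:E = (b^-1)%:E)%E.
  rewrite (ge0_FTC2_oo (G := fun t => - b^-1 * (1 - t) `^ b))//.
  - rewrite subrr subr0 powR0 ?gt_eqF// mulr0 sub0r powR1 mulr1 opprK.
    by [].
  - move=> t; rewrite in_itv/= => /andP[_ t1].
    apply: (@continuous_comp _ _ _ (fun t => 1 - t) (@powR R ^~ (b - 1))).
      by apply: cvgB => //; exact: cvg_cst.
    by apply: continuous_powR; rewrite subr_gt0.
  - split.
    + by move=> t; rewrite in_itv/= => /andP[_ t1]; have [] := dh t t1.
    + apply: cvg_at_right_filter; apply: cvgMr.
      apply: (@continuous_comp _ _ _ (fun t => 1 - t) (@powR R ^~ b)).
        by apply: cvgB => //; exact: cvg_cst.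
      by apply: continuous_powR; rewrite subr0.
    + apply: cvgMr; rewrite subrr powR0 ?gt_eqF//.
      apply: (@cvg_comp _ _ _ (fun t => 1 - t) (@powR R ^~ b) _ (0^'+)).
        move=> A [e /= e0 hA]; near=> t.
        have t1 : t < 1 by near: t; exact: nbhs_left_lt.
        apply: hA; last by rewrite subr_gt0.
        rewrite /ball_/= sub0r normrN gtr0_norm ?subr_gt0//.
        by rewrite ltrBlDr -ltrBlDl; near: t; apply: nbhs_left_gt; lra.
      exact: powR_cvg0.
  - move=> t; rewrite in_itv/= => /andP[_ t1].
    by rewrite derive1E; have [_ ->] := dh t t1.
have mh (D : set R) : measurable_fun D h.
  apply: measurable_funTS; apply: (measurableT_comp (measurable_powR _)).
  by apply: measurable_funB.
apply/integrableP; split; first by apply/measurable_EFinP; exact: measurable_Fp_fun.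
rewrite -integral_itv_bndo_bndc; last first.
  by apply: measurableT_comp => //; apply/measurable_EFinP; exact: measurable_Fp_fun.
rewrite -integral_itv_obnd_cbnd; last first.
  by apply: measurableT_comp => //; apply/measurable_EFinP; exact: measurable_Fp_fun.
apply: (@le_lt_trans _ _ (\int[mu]_(t in `]0%R, 1%R[) (h t)%:E)%E); last first.
  by rewrite intE ltry.
apply: ge0_le_integral => //.
- by apply: measurableT_comp => //; apply/measurable_EFinP; exact: measurable_Fp_fun.
- by apply/measurable_EFinP; exact: mh.
- move=> t; rewrite /= in_itv/= => /andP[t0 t1].
  rewrite lee_fin ger0_norm ?Fp_fun_ge0// /f /h /b addrAC subrr add0r.
  apply: le_powRN; [by rewrite invr_ge0 ltW|by rewrite subr_gt0|].
  by rewrite lerD2l lerN2 ge1r_powR ?t0 ?ltW.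
Unshelve. all: by end_near. Qed.

Lemma Fp0 : F 0 = 0.
Proof. by rewrite /Fp set_itv1 Rintegral_set1. Qed.

Lemma integrable_Fp_sub (D : set R) : measurable D -> D `<=` `[0, 1]%classic ->
  mu.-integrable D (EFin \o f).
Proof. by move=> mD D01; apply: integrableS integrable_Fp_fun. Qed.

Lemma Fp_sub y z : 0 <= y -> y < z -> z <= 1 ->
  F z - F y = \int[mu]_(t in `]y, z[) f t.
Proof.
move=> y0 yz z1; rewrite /Fp Rintegral_itvB ?bnd_simp ?(ltW yz)//.
  rewrite -Rintegral_itv_bndo_bndc//; apply: integrable_Fp_sub => //.
  by apply: subset_itv; rewrite bnd_simp// ltW.
by apply: integrable_Fp_sub => //; apply: subset_itv; rewrite bnd_simp.
Qed.

Lemma Fp_sub_ge y z : 0 <= y -> y < z -> z <= 1 -> (z - y) * f y <= F z - F y.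
Proof.
move=> y0 yz z1; rewrite (Fp_sub y0 yz z1) -(Rintegral_cst_oo _ yz).
apply: le_Rintegral.
- exact: measurable_itv.
- exact: integrable_cst_oo.
- apply: integrable_Fp_sub; first exact: measurable_itv.
  by apply: subset_itv; rewrite bnd_simp// ltW.
- move=> t; rewrite /= in_itv/= => /andP[yt tz].
  by rewrite le_Fp_fun ?(ltW yt)// (lt_le_trans tz).
Qed.

Lemma Fp_sub_le y z : 0 <= y -> y < z -> z < 1 -> F z - F y <= (z - y) * f z.
Proof.
move=> y0 yz z1; rewrite (Fp_sub y0 yz (ltW z1)) -(Rintegral_cst_oo _ yz).
apply: le_Rintegral.
- exact: measurable_itv.
- apply: integrable_Fp_sub; first exact: measurable_itv.
  by apply: subset_itv; rewrite bnd_simp// ltW.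
- exact: integrable_cst_oo.
- move=> t; rewrite /= in_itv/= => /andP[yt tz].
  by rewrite le_Fp_fun ?(ltW tz)// (le_trans y0)// ltW.
Qed.

Lemma Fp_lt y z : 0 <= y -> y < z -> z <= 1 -> F y < F z.
Proof.
move=> y0 yz z1; rewrite -subr_gt0 (lt_le_trans _ (Fp_sub_ge y0 yz z1))//.
rewrite mulr_gt0 ?subr_gt0// (lt_le_trans _ (Fp_fun_ge1 y0 _))//.
exact: lt_le_trans z1.
Qed.

Lemma Fp_ge y : 0 <= y -> y <= 1 -> y <= F y.
Proof.
rewrite le_eqVlt => /predU1P[<-|y0 y1]; first by rewrite Fp0.
by have := Fp_sub_ge (lexx 0) y0 y1; rewrite Fp0 !subr0 Fp_fun0 mulr1.
Qed.

(** Strictness comes from cutting at y / 2: on the left half the integrand is at most f(y / 2) <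
    f(y). *)
Lemma Fp_lt_mul y : 0 < y -> y < 1 -> F y < y * f y.
Proof.
move=> y0 y1; have y20 : 0 < y / 2 by rewrite divr_gt0.
have y2 : y / 2 < y by lra.
have y21 := lt_trans y2 y1.
have h1 := Fp_sub_le (lexx 0) y20 y21.
have h2 := Fp_sub_le (ltW y20) y2 y1.
have h3 : y / 2 * f (y / 2) < y / 2 * f y by rewrite ltr_pM2l// lt_Fp_fun// ltW.
rewrite Fp0 !subr0 in h1.
rewrite (_ : y - y / 2 = y / 2) in h2; last by field.
rewrite (_ : y * f y = y / 2 * f y + y / 2 * f y); last by field.
rewrite -[ltLHS](subrK (F (y / 2))).
by apply: ler_ltD h2 _; exact: le_lt_trans h1 h3.
Qed.

(** On ]y, z[ the integrand is at least f(y), which exceeds its mean F y / y over ]0, y[; extending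
    the interval therefore raises the mean. *)
Lemma Fp_ratio y z : 0 < y -> y < z -> z <= 1 -> F y / y < F z / z.
Proof.
move=> y0 yz z1; have z0 := lt_trans y0 yz.
rewrite ltr_pdivrMr// mulrAC ltr_pdivlMr//.
have h1 := Fp_sub_ge (ltW y0) yz z1.
have h2 := Fp_lt_mul y0 (lt_le_trans yz z1).
have : F y * (z - y) < y * f y * (z - y) by rewrite ltr_pM2r// subr_gt0.
have : y * ((z - y) * f y) <= y * (F z - F y) by rewrite ler_pM2l.
by nra.
Qed.

Lemma Fp_continuous : {within `[0, 1], continuous F}.
Proof. exact: parameterized_integral_continuous integrable_Fp_fun. Qed.

Lemma Fp_inj : {in `[0, 1]%classic &, injective F}.
Proof.
move=> y z; rewrite !inE/= !in_itv/= => /andP[y0 y1] /andP[z0 z1] yz.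
apply/eqP/negPn/negP; rewrite neq_lt => /orP[lt|lt].
  by have := Fp_lt y0 lt z1; rewrite yz ltxx.
by have := Fp_lt z0 lt y1; rewrite yz ltxx.
Qed.

Local Notation D := (F 1).

Lemma Fp1_gt1 : 1 < D.
Proof.
have h : 2^-1 < 1 :> R by rewrite invf_lt1// ltr1n.
have h0 : 0 < 2^-1 :> R by [].
have := Fp_ratio h0 h (lexx 1); rewrite divr1; apply: le_lt_trans.
by rewrite ler_pdivlMr// mul1r Fp_ge// ltW.
Qed.

Lemma Fp_surj x : 0 <= x -> x <= D -> exists2 y, y \in `[0, 1] & F y = x.
Proof.
move=> x0 xD; apply: IVT => //; first exact: Fp_continuous.
rewrite Fp0 min_l ?max_r; first by rewrite x0.
  by rewrite (le_trans x0).
by rewrite (le_trans x0).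
Qed.

Lemma arc_sinpK y : 0 <= y -> y <= 1 -> arc_sinp p (F y) = y.
Proof.
move=> y0 y1; rewrite /arc_sinp pinvKV//; first exact: Fp_inj.
by rewrite inE/= in_itv/= y0.
Qed.

Lemma arc_sinp_out x : ~ (0 <= x <= D) -> arc_sinp p x = 0.
Proof.
move=> nx; apply: pinv_dflt => -[y /=]; rewrite in_itv/= => /andP[y0 y1] yx.
apply: nx; rewrite -yx (le_trans y0) ?Fp_ge//=.
move: y1; rewrite le_eqVlt => /predU1P[->//|y1].
by rewrite ltW// Fp_lt.
Qed.

Lemma arc_sinp_itv x : 0 <= arc_sinp p x <= 1.
Proof.
have [/andP[x0 xD]|/negP nx] := boolP (0 <= x <= D).
  have [y /[!in_itv]/= /andP[y0 y1] <-] := Fp_surj x0 xD.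
  by rewrite arc_sinpK// y0.
by rewrite arc_sinp_out// lexx/=.
Qed.

(** On [0, F 1] it is continuous, as the inverse of a continuous map of a segment; elsewhere it is
    0. *)
Lemma measurable_arc_sinp : measurable_fun setT (arc_sinp p).
Proof.
have -> : arc_sinp p = arc_sinp p \_ `[0, D]%classic.
  apply/funext => x; rewrite patchE; case: ifPn => // nx.
  by rewrite arc_sinp_out// => xD; move: nx; rewrite mem_setE in_itv/= xD.
apply/(measurable_restrictT _ (measurable_itv _)).
apply: subspace_continuous_measurable_fun; first exact: measurable_itv.
rewrite -[X in `[X, _]]Fp0; apply: segment_can_le_continuous => //.
  exact: Fp_continuous.
by move=> y; rewrite in_itv/= => /andP[y0 y1]; exact: arc_sinpK.
Qed.

Lemma pipE : pip p = 2 * D. Proof. by []. Qed.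

Lemma abs_sinp x : `|sinp p x| = arc_sinp p
  (Num.min `|x - 2 * pip p * (Num.floor (x / (2 * pip p) + 2^-1))%:~R|
   (pip p - `|x - 2 * pip p * (Num.floor (x / (2 * pip p) + 2^-1))%:~R|)).
Proof.
rewrite /sinp; set y := x - _; rewrite normrM normr_sg.
have /andP[a0 _] := arc_sinp_itv (Num.min `|y| (pip p - `|y|)).
(* At y = 0 the sign is 0 rather than 1, but the inverse also vanishes there. *)
have [y0|y0] := eqVneq y 0; last by rewrite mul1r ger0_norm.
rewrite mul0r y0 normr0 subr0 min_l; first by rewrite -[in RHS]Fp0 arc_sinpK.
by rewrite pipE mulr_ge0// ltW// (lt_trans _ Fp1_gt1).
Qed.

Lemma sinp_le1 x : `|sinp p x| <= 1.
Proof. by rewrite abs_sinp; have /andP[] := arc_sinp_itv (Num.min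
   `|x - 2 * pip p * (Num.floor (x / (2 * pip p) + 2^-1))%:~R|
   (pip p - `|x - 2 * pip p * (Num.floor (x / (2 * pip p) + 2^-1))%:~R|)). Qed.

Lemma sinp_Fp y : 0 < y -> y <= 1 -> sinp p (F y) = y.
Proof.
move=> y0 y1; have D1 := Fp1_gt1; have yF := Fp_ge (ltW y0) y1.
have Fy0 : 0 < F y by exact: lt_le_trans yF.
have FyD : F y <= D.
  by move: y1; rewrite le_eqVlt => /predU1P[->//|y1]; rewrite ltW// Fp_lt// ltW.
have pip0 : 0 < 2 * pip p by rewrite pipE; lra.
(* The period is 4 F(1) and 0 < F y <= F(1), so the argument of the floor lies between 1/2 and
   3/4. *)
rewrite /sinp (_ : Num.floor _ = 0); last first.
  apply: floor_def; rewrite add0r mulr1z mulr0z.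
  rewrite addr_ge0 ?divr_ge0 ?(ltW Fy0) ?(ltW pip0)//=.
  by rewrite -ltrBrDr ltr_pdivrMr// pipE; lra.
rewrite mulr0z mulr0 subr0 gtr0_sg// mul1r gtr0_norm// pipE min_l.
  by rewrite arc_sinpK// ltW.
lra.
Qed.

Lemma measurable_sinp_ratio : measurable_fun setT (fun x => `|sinp p x / x|).
Proof.
have mfloor : measurable_fun setT (fun x : R => (Num.floor x)%:~R : R).
  by apply: nondecreasing_measurable => // x y xy; rewrite ler_int le_floor.
pose Y x := x - 2 * pip p * (Num.floor (x / (2 * pip p) + 2^-1))%:~R.
have mY : measurable_fun setT Y.
  apply: measurable_funB => //; apply: measurable_funM => //.
  apply: (measurableT_comp mfloor); apply: measurable_funD => //.
  exact: measurable_funM.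
have mY1 : measurable_fun setT (fun x => `|Y x|) by apply: measurableT_comp.
rewrite (_ : (fun x => _) = fun x =>
    arc_sinp p (Num.min `|Y x| (pip p - `|Y x|)) * `|x| `^ (-1)); last first.
  by apply/funext => x; rewrite normrM abs_sinp normfV powR_inv1.
apply: measurable_funM.
  apply: (measurableT_comp measurable_arc_sinp).
  by apply: measurable_minr => //; exact: measurable_funB.
exact: (measurableT_comp (measurable_powR _)).
Qed.

End Fp.

(** * Level sets of |sin_p x / x| and the expansion of F y / y *)

Section sinp_level.
Context {R : realType} (p : R) (hp : 1 < p).
Implicit Types (x y z t r : R) (c : nat -> R).
Local Notation mu := (@lebesgue_measure R).
Local Notation F := (Fp p).
Local Notation f := (Fp_fun p).
Local Notation D := (F 1).

Let p0 : 0 < p. Proof. by rewrite (lt_trans _ hp). Qed.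
Let D1 : 1 < D. Proof. exact: Fp1_gt1. Qed.

Definition sinp_ratio x := `|sinp p x / x|.

Lemma sinp_ratio_mul x : 0 < x -> x * sinp_ratio x <= 1.
Proof.
move=> x0; rewrite /sinp_ratio normrM normfV (gtr0_norm x0) mulrC divfK ?gt_eqF//.
exact: sinp_le1.
Qed.

Lemma Fp_gt0 y : 0 < y -> y <= 1 -> 0 < F y.
Proof. by move=> y0 y1; rewrite (lt_le_trans y0)// (Fp_ge hp (ltW y0) y1). Qed.

Lemma sinp_ratio_Fp y : 0 < y -> y <= 1 -> sinp_ratio (F y) = y / F y.
Proof.
move=> y0 y1; rewrite /sinp_ratio (sinp_Fp hp y0 y1) gtr0_norm//.
by rewrite divr_gt0// Fp_gt0.
Qed.

Lemma sinp_ratio_out x : D <= x -> sinp_ratio x <= D^-1.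
Proof.
have D0 : 0 < D by exact: lt_trans D1.
move=> Dx; have x0 := lt_le_trans D0 Dx.
rewrite -div1r ler_pdivlMr// (le_trans _ (sinp_ratio_mul x0))// mulrC.
by rewrite ler_wpM2r// normr_ge0.
Qed.

Lemma Fp_surj_gt0 x : 0 < x -> x <= D -> exists y, [/\ 0 < y, y <= 1 & F y = x].
Proof.
move=> x0 xD; have [y yI yx] := Fp_surj hp (ltW x0) xD.
move: yI; rewrite in_itv/= => /andP[y0 y1]; exists y; split=> //.
rewrite lt_neqAle y0 andbT; apply/negP => /eqP y00.
by move: x0; rewrite -yx -y00 Fp0 ltxx.
Qed.

Lemma sinp_ratio_itv x : 0 < x -> 0 <= sinp_ratio x <= 1.
Proof.
move=> x0; rewrite normr_ge0/=; have [xD|Dx] := ltP x D; last first.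
  by rewrite (le_trans (sinp_ratio_out Dx))// invf_le1 ?(ltW D1)// (lt_trans _ D1).
have [y [y0 y1 <-]] := Fp_surj_gt0 x0 (ltW xD).
rewrite (sinp_ratio_Fp y0 y1) ler_pdivrMr ?Fp_gt0// mul1r.
exact: (Fp_ge hp (ltW y0) y1).
Qed.

(** Intermediate values for F y - e^r y. This vanishes at 0, so a positive left end where it is
    negative is needed; at 1 it is positive. *)
Lemma Fp_eq_expR r : 0 < r -> expR r < D ->
  exists y, [/\ 0 < y, y < 1 & F y = expR r * y].
Proof.
move=> r0 rD; pose e := expR (- (r * p)).
have e1 : 0 < 1 - e by rewrite subr_gt0 expR_lt1 oppr_lt0 mulr_gt0.
(* The point where the integrand equals e^r, so that F z < z f(z) = e^r z. *)
pose z := (1 - e) `^ p^-1.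
have z0 : 0 < z by exact: powR_gt0.
have zp : z `^ p = 1 - e by rewrite -powRrM mulVf ?gt_eqF// powRr1// ltW.
have z1 : z < 1.
  rewrite ltNge; apply/negP => z1; have : 1 <= z `^ p.
    by rewrite -(powRr0 z) ler_powR// ltW.
  by rewrite zp; have := expR_gt0 (- (r * p)); rewrite -/e; lra.
have fz : f z = expR r.
  rewrite /Fp_fun zp opprB addrC subrK /e -expRM.
  by rewrite mulrN mulNr opprK mulfK// gt_eqF.
pose H y := F y - expR r * y.
have cH : {within `[z, 1], continuous H}.
  move=> y; apply: continuousB.
    have sub : `[z, 1]%classic `<=` (`[0, 1]%classic : set R).
      by apply: subset_itvr; rewrite bnd_simp ltW.
    exact: (continuous_subspaceW sub (Fp_continuous hp)).
  by apply: continuous_subspaceT => t; apply: cvgMr.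
have Hz : H z < 0 by rewrite subr_lt0 -fz mulrC (Fp_lt_mul hp z0 z1).
have H1 : 0 < H 1 by rewrite subr_gt0 mulr1.
have H0 : Num.min (H z) (H 1) <= 0 <= Num.max (H z) (H 1).
  by rewrite min_l ?max_r ?(ltW (lt_trans Hz H1))// !ltW.
have [y yI Hy] := IVT (ltW z1) cH H0.
move: yI; rewrite in_itv/= => /andP[zy y1].
exists y; split; first exact: lt_le_trans zy.
  rewrite lt_neqAle y1 andbT; apply/negP => /eqP y11.
  by move: H1; rewrite -y11 Hy ltxx.
by apply/eqP; rewrite -subr_eq0; apply/eqP.
Qed.

(** Up to F(1) write x = F z: the ratio is z / F z, strictly decreasing in z, with value e^-r at z =
    y. From F(1) on it is at most 1 / F(1) < e^-r. *)
Lemma level_set_sinp r y : 0 < y -> y < 1 -> F y = expR r * y -> expR r < D ->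
  level_set sinp_ratio r = `]0, F y[%classic.
Proof.
move=> y0 y1 yr rD.
have rE : expR r = F y / y by rewrite yr mulfK// gt_eqF.
have gt z : 0 < z -> z <= 1 -> (expR (- r) < z / F z) = (F z / z < expR r).
  move=> z0 z1; rewrite expRN -[z / _]invf_div ltf_pV2// posrE ?expR_gt0//.
  by rewrite divr_gt0// Fp_gt0.
apply/seteqP; split => x.
  move=> [x0 xr]; rewrite /= in_itv/= x0/=.
  have [xD|Dx] := ltP x D; last first.
    have := lt_le_trans xr (sinp_ratio_out Dx).
    rewrite expRN ltf_pV2 ?posrE ?expR_gt0 ?(lt_trans _ D1)// => Dr.
    by have := lt_trans Dr rD; rewrite ltxx.
  have [z [z0 z1 zx]] := Fp_surj_gt0 x0 (ltW xD).
  move: xr; rewrite -zx (sinp_ratio_Fp z0 z1) (gt _ z0 z1) rE => zy.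
  apply: (Fp_lt hp (ltW z0) _ (ltW y1)).
  rewrite ltNge; apply/negP; rewrite le_eqVlt => /predU1P[yz|yz].
    by rewrite yz ltxx in zy.
  by have := Fp_ratio hp y0 yz z1; rewrite ltNge (ltW zy).
rewrite /= in_itv/= => /andP[x0 xy].
have xD : x <= D.
  by rewrite (le_trans (ltW xy))// ltW// (Fp_lt hp (ltW y0) y1 (lexx 1)).
have [z [z0 z1 zx]] := Fp_surj_gt0 x0 xD.
split; first exact: x0.
rewrite -zx (sinp_ratio_Fp z0 z1) (gt _ z0 z1) rE.
apply: (Fp_ratio hp z0 _ (ltW y1)).
rewrite ltNge; apply/negP; rewrite le_eqVlt => /predU1P[yz|yz].
  by move: xy; rewrite -zx yz ltxx.
by have := Fp_lt hp (ltW y0) yz z1; rewrite zx ltNge (ltW xy).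
Qed.

Lemma level_measure_sinp r y : 0 < y -> y < 1 -> F y = expR r * y -> expR r < D ->
  level_measure sinp_ratio r = F y.
Proof.
move=> y0 y1 yr rD; rewrite /level_measure (level_set_sinp y0 y1 yr rD).
by rewrite (fine_itv_oo (Fp_gt0 y0 (ltW y1))) subr0.
Qed.

Lemma integral_sum_powR c n y : 0 < y ->
  mu.-integrable `]0, y[ (EFin \o (fun t : R => \sum_(i < n) c i * (t `^ p) ^+ i)) /\
  \int[mu]_(t in `]0, y[) (\sum_(i < n) c i * (t `^ p) ^+ i) =
  y * \sum_(i < n) c i / (i%:R * p + 1) * (y `^ p) ^+ i.
Proof.
move=> y0; elim: n => [|n [IH1 IH2]].
  have -> : (fun t : R => \sum_(i < 0) c i * (t `^ p) ^+ i) = cst 0.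
    by apply/funext => t; rewrite big_ord0.
  split; first exact: integrable0.
  by rewrite big_ord0 mulr0 /Rintegral integral0.
pose g t := \sum_(i < n) c i * (t `^ p) ^+ i.
pose z := n%:R * p + 1.
have z0 : 0 < z by rewrite ltr_wpDl// mulr_ge0// ltW.
pose h t := z * t `^ (z - 1).
have mh (A : set R) : measurable_fun A h.
  by apply: measurable_funTS; apply: measurable_funM.
have hI : mu.-integrable `]0, y[ (EFin \o h).
  apply/integrableP; split; first by apply/measurable_EFinP; exact: mh.
  apply: (@le_lt_trans _ _ (\int[mu]_(t in `]0%R, y[) (z * t `^ (z - 1))%:E)%E).
    rewrite le_eqVlt; apply/orP; left; apply/eqP; apply: eq_integral => t _.
    by rewrite /= ger0_norm// mulr_ge0 ?powR_ge0// ltW.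
  by rewrite (integral_powR_itv0o z0 y0) ltry.
have hE : \int[mu]_(t in `]0, y[) h t = y `^ z.
  by rewrite /Rintegral (integral_powR_itv0o z0 y0).
pose k t := c n / z * h t.
have kI : mu.-integrable `]0, y[ (EFin \o k).
  rewrite (_ : EFin \o k = (fun t => (c n / z)%:E * (h t)%:E)%E); last first.
    by apply/funext => t /=; rewrite EFinM.
  exact: integrableZl.
have pow t : 0 <= t -> (t `^ p) ^+ n = t `^ (n%:R * p).
  by move=> t0; rewrite mulrC powRrM powR_mulrn// powR_ge0.
have gkE t : t \in `]0, y[%classic ->
    \sum_(i < n.+1) c i * (t `^ p) ^+ i = g t + k t.
  rewrite inE/= in_itv/= => /andP[t0 _]; rewrite big_ord_recr/= pow ?(ltW t0)//.
  by rewrite /k /h /z addrK; congr (_ + _); field; rewrite gt_eqF.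
split.
  have : mu.-integrable `]0, y[ ((EFin \o g) \+ (EFin \o k))%E.
    exact: integrableD.
  by apply: eq_integrable => // t t0; rewrite /= gkE// EFinD.
transitivity (\int[mu]_(t in `]0, y[) (g t + k t)); first exact: eq_Rintegral.
rewrite RintegralD// big_ord_recr/= mulrDr -IH2; congr (_ + _).
rewrite /k RintegralZl// hE pow ?(ltW y0)//.
rewrite /z powRD ?(gt_eqF y0) ?implybT// powRr1 ?(ltW y0)//.
by field; rewrite -/z gt_eqF.
Qed.

(** Binomial coefficients of (1 - t^p)^(-1/p), with i p + 1 from integrating t^(i p). These are the
    coefficients of the hypergeometric series 2F1(1/p, 1/p; 1 + 1/p; u). *)
Definition ratio_coef i := (-1) ^+ i * binom_coef (- p^-1) i / (i%:R * p + 1).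

(** On ]0, y[ the binomial remainder C (t^p)^n is at most C (y^p)^n, and taking the mean over ]0, y[
    preserves this bound. *)
Lemma expands_Fp_ratio n : expands (0 : R)^'+ n (@powR R ^~ p)
  (fun y => F y / y) (\poly_(i < n) ratio_coef i).
Proof.
have [C C0 hC] := expands_powR (- p^-1) n.
have /nbhs_ballP[e /= e0 he] := hC.
exists C => //.
have up0 := powR_cvg0 p0.
near=> y.
have y0 : 0 < y by [].
have y1 : y < 1 by near: y; exact: nbhs_right_lt.
have ye : y `^ p < e.
  rewrite -(ger0_norm (powR_ge0 y p)); near: y.
  exact: (cvgr0_norm_lt _ up0).
pose b i := (-1) ^+ i * binom_coef (- p^-1) i.
pose B t := \sum_(i < n) b i * (t `^ p) ^+ i.
have [BI BE] := integral_sum_powR b n y0.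
have fI : mu.-integrable `]0, y[ (EFin \o f).
  apply: (integrable_Fp_sub hp); first exact: measurable_itv.
  by apply: subset_itv; rewrite bnd_simp// ltW.
have FE : F y = \int[mu]_(t in `]0, y[) f t.
  by rewrite -(Fp_sub hp (lexx 0) y0 (ltW y1)) Fp0 subr0.
have -> : F y / y - (\poly_(i < n) ratio_coef i).[y `^ p] =
    (\int[mu]_(t in `]0, y[) (f t - B t)) / y.
  rewrite RintegralB// BE -FE horner_poly mulrBl.
  by rewrite [_ * _ / y]mulrAC mulfV ?mul1r ?gt_eqF.
rewrite normrM normfV (gtr0_norm y0) ler_pdivrMr//.
have dI : mu.-integrable `]0, y[ (EFin \o (fun t => f t - B t)).
  rewrite (_ : EFin \o _ = (fun t => (f t)%:E - (B t)%:E)%E); last first.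
    by apply/funext => t /=; rewrite EFinB.
  exact: integrableB.
apply: (le_trans (le_normr_Rintegral _ dI)); first exact: measurable_itv.
rewrite [leRHS]mulrC -[X in X * _]subr0 -(Rintegral_cst_oo _ y0).
apply: le_Rintegral.
- exact: measurable_itv.
- exact: (integrable_norm dI).
- exact: integrable_cst_oo.
- move=> t; rewrite /= in_itv/= => /andP[t0 ty].
  have tp : t `^ p <= y `^ p by apply: ge0_ler_powR; rewrite ?nnegrE// ltW.
  have := he (- t `^ p); rewrite /ball/= sub0r opprK (ger0_norm (powR_ge0 _ _)).
  move=> /(_ (le_lt_trans tp ye)); rewrite -/(f t) normrN.
  rewrite (_ : (binom_poly _ _).[_] = B t).
    move=> /le_trans; apply; rewrite ler_wpM2l//.
    by rewrite lerXn2r ?nnegrE// !ger0_norm ?powR_ge0.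
  rewrite /binom_poly horner_poly; apply: eq_bigr => i _.
  by rewrite /b -[- (t `^ p)]mulN1r exprMn; ring.
Unshelve. all: by end_near. Qed.

End sinp_level.

(** * Change of gauge from u to s, and the expansion of F y *)

Section sinp_expansion.
Context {R : realType} (p : R) (hp : 1 < p).
Implicit Types (y r : R).
Local Notation F := (Fp p).

Let p0 : 0 < p. Proof. by rewrite (lt_trans _ hp). Qed.

Let a := (p * (p + 1))^-1.
Let b := (p + 1) / (2 * p ^+ 2 * (2 * p + 1)).

Let u y := y `^ p.
Let v y := F y / y - 1.
Let s y := ln (F y / y).

Let p_neq0 : p != 0. Proof. by rewrite gt_eqF. Qed.
Let p1_neq0 : p + 1 != 0. Proof. by rewrite gt_eqF// addr_gt0. Qed.
Let a_neq0 : a != 0. Proof. by rewrite invr_eq0 mulf_neq0. Qed.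

Let ratio_coefE : [/\ ratio_coef p 0 = 1, ratio_coef p 1 = a & ratio_coef p 2 = b].
Proof.
have h2 : 2 * p + 1 != 0 by rewrite gt_eqF// addr_gt0// mulr_gt0.
rewrite /ratio_coef /binom_coef !big_ord_recr !big_ord0/= /a /b; split.
- by rewrite mul0r add0r fact0 !divr1 expr0 mul1r.
- by rewrite !factS fact0; field; rewrite p_neq0 p1_neq0.
- by rewrite !factS fact0; field; rewrite p_neq0 h2.
Qed.

Let u_cvg0 : u y @[y --> (0 : R)^'+] --> (0 : R).
Proof. exact: powR_cvg0. Qed.

Let expands_v n : expands (0 : R)^'+ n u v ((\poly_(i < n) ratio_coef p i) - 1%:P).
Proof. exact: (expandsB (expands_Fp_ratio hp n) (expands_cst _ _ 1)). Qed.

Let v_coef n i : (i < n.+2)%N ->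
  ((\poly_(i < n.+2) ratio_coef p i) - 1%:P)`_i =
  if i == 0%N then 0 else ratio_coef p i.
Proof.
move=> ilt; rewrite coefB coef_poly ilt coefC; case: eqP => [->|_]; last by rewrite subr0.
by case: ratio_coefE => -> _ _; rewrite subrr.
Qed.

Let v_cvg0 : v y @[y --> (0 : R)^'+] --> (0 : R).
Proof.
apply: (bigoh1_cvg u_cvg0); apply: (expands_bigoh1 u_cvg0 _ _ (expands_v 2)) => //.
by rewrite v_coef.
Qed.

Let v_gt0 : \forall y \near (0 : R)^'+, 0 < v y.
Proof.
near=> y; have y0 : 0 < y by [].
have y1 : y <= 1 by near: y; exact: nbhs_right_le.
have y20 : 0 < y / 2 by rewrite divr_gt0.
have y2 : y / 2 < y by rewrite ltr_pdivrMr// ltr_pMr// ltr1n.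
rewrite subr_gt0 (le_lt_trans _ (Fp_ratio hp y20 y2 y1))//.
rewrite ler_pdivlMr// mul1r (Fp_ge hp (ltW y20))//.
by rewrite (le_trans _ y1)// ltW.
Unshelve. all: by end_near. Qed.

Let s_gt0 : \forall y \near (0 : R)^'+, 0 < s y.
Proof. by move: v_gt0; apply: filterS => y; rewrite subr_gt0 => h; rewrite ln_gt0. Qed.

Let s_neq0 : \forall y \near (0 : R)^'+, s y != 0.
Proof. by move: s_gt0; apply: filterS => y /gt_eqF->. Qed.

Let expR_s : \forall y \near (0 : R)^'+, expR (s y) = F y / y.
Proof.
move: v_gt0; apply: filterS => y; rewrite subr_gt0 => h; rewrite lnK//.
by rewrite posrE (lt_trans _ h).
Qed.

Let s_cvg0 : s y @[y --> (0 : R)^'+] --> (0 : R).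
Proof.
suff : s y @[y --> (0 : R)^'+] --> ln (1 : R) by rewrite ln1.
apply: (@cvg_comp _ _ _ (fun y => F y / y) (@ln R) _ (nbhs (1 : R))); last first.
  exact: continuous_ln.
rewrite (_ : (fun y => F y / y) = fun y => v y + 1); last first.
  by apply/funext => y; rewrite subrK.
have h : v y + 1 @[y --> (0 : R)^'+] --> (0 + 1 : R).
  by apply: cvgD; [exact: v_cvg0|exact: cvg_cst].
by rewrite add0r in h.
Qed.

Let expands_expR_s n : expands (0 : R)^'+ n s (expR \o s) (exp_poly n).
Proof. by apply: expands_subst => //; exact: expands_expR. Qed.

Let expands_v_s n : expands (0 : R)^'+ n s v (exp_poly n - 1%:P).
Proof.
apply: bigoh_near (expandsB (expands_expR_s n) (expands_cst _ _ 1)).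
by move: expR_s; apply: filterS => y /= ->.
Qed.

Let exp_poly_coef n i : (i < n)%N ->
  (exp_poly n - 1%:P : {poly R})`_i = if i == 0%N then 0 else (i`!%:R)^-1.
Proof.
move=> ilt; rewrite coefB coef_poly ilt coefC; case: eqP => [->|_].
  by rewrite fact0 invr1 subrr.
by rewrite subr0.
Qed.

Let sqr_coef (U : {poly R}) : U`_0 = 0 ->
  (U ^+ 2)`_1 = 0 /\ (U ^+ 2)`_2 = U`_1 ^+ 2.
Proof.
move=> U0; rewrite expr2 !coefM !big_ord_recr !big_ord0/= U0; split; ring.
Qed.

(** Existence: u expands in v by inversion, and v = e^s - 1 expands in s. The coefficients solve a
    U1 = 1 and a U2 + b U1^2 = 1/2. *)
Let expands_u_s n : exists U, [/\ expands (0 : R)^'+ n.+3 s u U, U`_0 = 0,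
  U`_1 = a^-1 & U`_2 = (2^-1 - b / a ^+ 2) / a].
Proof.
have vP m : exists P, [/\ expands (0 : R)^'+ m u v P, P`_0 = 0 & P`_1 = a].
  exists ((\poly_(i < m.+2) ratio_coef p i) - 1%:P); split.
  - by apply: (expands_le u_cvg0) (expands_v m.+2); rewrite -addn2 leq_addr.
  - by rewrite v_coef.
  - by rewrite v_coef//=; case: ratio_coefE.
have [Q uQ Q0] := expands_inv u_cvg0 a_neq0 vP n.+3.
pose U := Q \Po (exp_poly n.+3 - 1%:P).
have uU : expands (0 : R)^'+ n.+3 s u U.
  by apply: (expands_comp s_cvg0 _ _ (expands_v_s n.+3) uQ) => //; rewrite exp_poly_coef.
have U0 : U`_0 = 0.
  by rewrite -horner_coef0 horner_comp horner_coef0 exp_poly_coef//= horner_coef0.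
(* A second expansion of v in s, through u; uniqueness against e^s - 1 gives the two equations. *)
have vU : expands (0 : R)^'+ 3 s v (((\poly_(i < 3) ratio_coef p i) - 1%:P) \Po U).
  apply: (expands_comp s_cvg0 _ U0 _ (expands_v 3)) => //.
  exact: (expands_le s_cvg0) uU.
have eqc := @expands_uniq R R _ (at_right_proper_filter 0) _ s _ _ _
  s_cvg0 s_neq0 vU (expands_v_s 3).
have PE : (\poly_(i < 3) ratio_coef p i) - 1%:P = a *: 'X + b *: 'X^2.
  apply/polyP => i; case: ratio_coefE => r0 r1 r2.
  rewrite coefB coefD !coefZ coefC coefX coefXn coef_poly.
  case: i => [|[|[|i]]]/=; rewrite ?r0 ?r1 ?r2 ?mulr0 ?mulr1 ?subr0 ?addr0 ?add0r//.
  by rewrite subrr.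
have cE i : (((\poly_(i < 3) ratio_coef p i) - 1%:P) \Po U)`_i =
    a * U`_i + b * (U ^+ 2)`_i.
  by rewrite PE comp_polyD !comp_polyZ comp_polyX comp_Xn_poly coefD !coefZ.
have [sq1 sq2] := sqr_coef U0.
have e1 := eqc 1%N isT; have e2 := eqc 2%N isT.
rewrite cE sq1 mulr0 addr0 exp_poly_coef//= !factS fact0 invr1 in e1.
rewrite cE sq2 exp_poly_coef//= !factS fact0 in e2.
have U1 : U`_1 = a^-1 by rewrite -[RHS]mul1r -e1 mulrAC mulfV// mul1r.
exists U; split=> //; apply: (mulfI a_neq0).
rewrite [RHS]mulrC mulfVK// -[LHS](addrK (b * U`_1 ^+ 2)) e2 U1 exprVn.
by rewrite muln1.
Qed.

(** The relative error of the leading term u ~ s / a; it tends to 0, as the binomial expansion of (1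
    + w)^(1/p) requires. *)
Let w y := a * (u y / s y) - 1.

Let expands_w_s n : exists W, [/\ expands (0 : R)^'+ n.+2 s w W, W`_0 = 0 &
  W`_1 = 2^-1 - b / a ^+ 2].
Proof.
have [U [uU U0 U1 U2]] := expands_u_s n.
exists (a *: drop_poly 1 U - 1%:P); split.
- by apply: expandsB; [apply/expandsZ/expands_divX|exact: expands_cst].
- by rewrite coefB coefZ coef_drop_poly coefC U1 mulfV// subrr.
- by rewrite coefB coefZ coef_drop_poly coefC U2 subr0 mulrC mulfVK.
Qed.

(** This is F y / s^(1/p) without the constant (p (p + 1))^(1/p). *)
Let h y := (1 + w y) `^ p^-1 * expR (s y).

Let w_cvg0 : w y @[y --> (0 : R)^'+] --> (0 : R).
Proof.
have [W [wW W0 _]] := expands_w_s 0.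
exact: (bigoh1_cvg s_cvg0 (expands_bigoh1 s_cvg0 _ W0 wW)).
Qed.

Let expands_h_s n (W : {poly R}) : expands (0 : R)^'+ n.+1 s w W -> W`_0 = 0 ->
  expands (0 : R)^'+ n.+1 s h
    ((binom_poly p^-1 n.+1 \Po W) * exp_poly n.+1).
Proof.
move=> wW W0; apply: (expandsM s_cvg0 _ (expands_expR_s n.+1)).
apply: (expands_comp s_cvg0 _ W0 wW) => //.
exact: (expands_subst w_cvg0 (expands_powR p^-1 n.+1)).
Qed.

Lemma Fp_expansion : exists c : nat -> R,
  [/\ c 0 = (p * (p + 1)) `^ p^-1,
      c 1 = (p * (p + 1)) `^ p^-1 * (1 + (2^-1 - b / a ^+ 2) / p) &
      forall n, expands (0 : R)^'+ n (fun y => ln (F y / y))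
        (fun y => F y / ln (F y / y) `^ p^-1) (\poly_(i < n) c i)].
Proof.
have hP n : exists P, expands (0 : R)^'+ n s h P.
  have [W [wW W0 _]] := expands_w_s n; eexists.
  by apply: (expands_le s_cvg0) (expands_h_s wW W0); rewrite -addn2 leq_addr.
have [c hc] := expands_coef s_cvg0 s_neq0 hP.
pose k := (p * (p + 1)) `^ p^-1.
have [W [wW W0 W1]] := expands_w_s 0.
have hcW := @expands_uniq R R _ (at_right_proper_filter 0) _ s _ _ _
  s_cvg0 s_neq0 (hc 2) (expands_h_s wW W0).
have BE : binom_poly p^-1 2 = 1%:P + p^-1 *: 'X.
  apply/polyP => i; rewrite coefD coefZ coefC coefX coef_poly /binom_coef.
  case: i => [|[|i]]/=; rewrite ?mulr0 ?addr0 ?mulr1 ?add0r//.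
    by rewrite big_ord0 divr1.
  by rewrite big_ord_recr big_ord0/= mul1r subr0 divr1.
have compE i : (binom_poly p^-1 2 \Po W)`_i = (i == 0%N)%:R + p^-1 * W`_i.
  rewrite BE comp_polyD comp_polyZ comp_polyC comp_polyX coefD coefZ coefC.
  by case: (i == 0%N).
have c0 : c 0%N = 1.
  have := hcW 0%N isT; rewrite coef_poly/= coefM big_ord1 compE W0 coef_poly/= => ->.
  by rewrite fact0 invr1 mulr0 addr0 mulr1.
have c1 : c 1%N = 1 + (2^-1 - b / a ^+ 2) / p.
  have := hcW 1%N isT.
  rewrite coef_poly/= coefM !big_ord_recr big_ord0/= !compE W0 W1 !coef_poly/= => ->.
  by rewrite !factS fact0; field; rewrite ?a_neq0 p_neq0.
exists (fun i => k * c i); split; [by rewrite c0 mulr1|by rewrite c1|move=> n].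
have -> : \poly_(i < n) (k * c i) = k *: \poly_(i < n) c i.
  by apply/polyP => i; rewrite coefZ !coef_poly; case: ifPn; rewrite ?mulr0.
apply: bigoh_near (expandsZ k (hc n)).
near=> y; congr (_ - _).
have y0 : 0 < y by [].
have sy : 0 < s y by near: y; exact: s_gt0.
have ey : expR (s y) = F y / y by near: y; exact: expR_s.
have uy : 0 < u y by exact: powR_gt0.
have kE : u y = s y * (p * (p + 1)) * (1 + w y).
  by rewrite /w subrKC /a; field; rewrite p_neq0 p1_neq0 gt_eqF.
have yE : y = u y `^ p^-1 by rewrite /u -powRrM mulfV// powRr1// ltW.
have pp : 0 <= p * (p + 1) by rewrite mulr_ge0// ?addr_ge0// ltW.
have w1 : 0 <= 1 + w y.
  rewrite /w subrKC mulr_ge0 ?invr_ge0// divr_ge0// ltW//.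
have FE : F y = u y `^ p^-1 * expR (s y) by rewrite -yE ey mulrC divfK// gt_eqF.
have sp : 0 <= s y * (p * (p + 1)) by apply: mulr_ge0 => //; exact: ltW.
rewrite -/(s y) FE kE (powRM _ sp w1) (powRM _ (ltW sy) pp) -/k /h.
by field; rewrite gt_eqF// powR_gt0.
Unshelve. all: by end_near. Qed.

End sinp_expansion.

(** For small r the point y with F y = e^r y has ln (F y / y) = r, so the expansion along y -> 0+
    becomes one in r, provided y is small when r is. *)
Lemma level_measure_expansion (R : realType) (p : R) (hp : 1 < p) (c : nat -> R) n :
  expands (0 : R)^'+ n (fun y => ln (Fp p y / y))
    (fun y => Fp p y / ln (Fp p y / y) `^ p^-1) (\poly_(i < n) c i) ->
  exists C : R, \forall r \near (0 : R)^'+,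
    `|level_measure (sinp_ratio p) r - r `^ p^-1 * \sum_(j < n) c j * r ^+ j|
      <= C * r `^ (n%:R + p^-1).
Proof.
move=> [C C0 [e /= e0 he]]; exists C.
(* Smallness of y comes from monotonicity alone: e^r < F y1 / y1 forces y < y1, which lies inside
   the radius [e]. *)
pose y1 := Num.min (e / 2) 2^-1.
have y10 : 0 < y1 by rewrite lt_min divr_gt0//= invr_gt0.
have y11 : y1 < 1 by rewrite gt_min invf_lt1// ltr1n orbT.
have y1e : y1 < e by rewrite gt_min ltr_pdivrMr// ltr_pMr// ltr1n.
have D1 := Fp1_gt1 hp.
have D0 : 0 < Fp p 1 by exact: lt_trans D1.
have k1 : 1 < Fp p y1 / y1.
  have y2 : y1 / 2 < y1 by rewrite ltr_pdivrMr// ltr_pMr// ltr1n.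
  have y20 : 0 < y1 / 2 by rewrite divr_gt0.
  rewrite (le_lt_trans _ (Fp_ratio hp y20 y2 (ltW y11)))//.
  rewrite ler_pdivlMr// mul1r (Fp_ge hp (ltW y20))//.
  by rewrite (le_trans (ltW y2))// ltW.
near=> r.
have r0 : 0 < r by [].
have rD : expR r < Fp p 1.
  rewrite -(lnK (x := Fp p 1)) ?posrE// ltr_expR.
  by near: r; apply: nbhs_right_lt; exact: ln_gt0.
have rk : expR r < Fp p y1 / y1.
  rewrite -(lnK (x := Fp p y1 / y1)) ?posrE ?(lt_trans _ k1)// ltr_expR.
  by near: r; apply: nbhs_right_lt; exact: ln_gt0.
have [y [y0 yl1 yr]] := Fp_eq_expR hp r0 rD.
have rE : Fp p y / y = expR r by rewrite yr mulfK// gt_eqF.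
have yy1 : y < y1.
  rewrite ltNge; apply/negP; rewrite le_eqVlt => /predU1P[yy|yy].
    by move: rk; rewrite yy rE ltxx.
  by have := Fp_ratio hp y10 yy (ltW yl1); rewrite rE ltNge (ltW rk).
rewrite (level_measure_sinp hp y0 yl1 yr rD).
have yball : ball_ Num.norm (0 : R) e y.
  by rewrite /ball_/= sub0r normrN gtr0_norm// (lt_trans yy1).
have := he y yball y0; rewrite rE expRK horner_poly (gtr0_norm r0) => h.
have rp0 : 0 < r `^ p^-1 by exact: powR_gt0.
have -> : Fp p y - r `^ p^-1 * \sum_(j < n) c j * r ^+ j =
    r `^ p^-1 * (Fp p y / r `^ p^-1 - \sum_(j < n) c j * r ^+ j).
  by field; rewrite gt_eqF.
have -> : C * r `^ (n%:R + p^-1) = r `^ p^-1 * (C * r ^+ n).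
  rewrite addrC powRD ?(gt_eqF r0) ?implybT// powR_mulrn ?(ltW r0)//.
  by rewrite mulrCA.
by rewrite normrM (gtr0_norm rp0) ler_pM2l.
Unshelve. all: by end_near. Qed.

Theorem theorem4p1 (R : realType) (p : R) (hp : 1 < p) :
  exists gamma : nat -> R,
    asymptotic_expansion (Ip p) (fun j : nat =>
      (p * (p + 1)) `^ p^-1 *
      match j with
      | 0%N => p^-1 * Gamma p^-1
      | 1%N => p^-1 * Gamma p^-1 *
               ((- p ^+ 2 + p + 1) * (p + 1) / (2 * p * (2 * p + 1)))
      | _ => Gamma (j%:R + p^-1) * gamma j
      end).
Proof.
have p0 : 0 < p by exact: lt_trans hp.
have ip0 : 0 < p^-1 by rewrite invr_gt0.
have [c [c0 c1 hc]] := Fp_expansion hp.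
pose k := (p * (p + 1)) `^ p^-1.
have k0 : k != 0 by rewrite gt_eqF// powR_gt0// mulr_gt0// addr_gt0.
have mg := measurable_sinp_ratio hp.
have gmul := sinp_ratio_mul hp.
have W : asymptotic_expansion (fun q => q `^ p^-1 *
    \int[lebesgue_measure]_(r in `]0, +oo[)
      (q * (level_measure (sinp_ratio p) r * expR (- (q * r)))))
    (fun j => c j * Gamma (j%:R + p^-1 + 1)).
  apply: watson => //.
  - exact: measurable_level_measure.
  - by move=> r r0; have [] := level_measure_bound mg gmul r0.
  - by move=> n; exact: level_measure_expansion.
(* Watson's lemma yields Gamma(j + 1/p + 1) = (j + 1/p) Gamma(j + 1/p), and the common factor [k] is
   taken out. *)
exists (fun j => c j * (j%:R + p^-1) / k) => N.
apply: cvg_trans (W N); apply: near_eq_cvg; near=> q.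
have q0 : 0 < q by near: q; apply: nbhs_pinfty_gt; exact: num_real.
rewrite /Ip -(layer_cake mg q0 (sinp_ratio_itv hp) gmul).
congr ((_ - _) / _); apply: eq_bigr => j _; congr (_ / _); rewrite -/k.
rewrite GammaS ?ltr_wpDl//.
case: (val j) => [|[|i]].
- by rewrite c0 add0r.
- have -> : Gamma (1%:R + p^-1) = p^-1 * Gamma p^-1 by rewrite addrC GammaS.
  (* With b / a^2 = (p + 1)^3 / (2 (2 p + 1)), the factor 1 + (1/2 - b / a^2) / p equals (-p^2 + p +
     1) / (2 (2 p + 1)); the remaining (p + 1) / p is 1 + 1/p from the recursion. *)
  rewrite c1 -/k; field.
  by rewrite !gt_eqF ?addr_gt0 ?mulr_gt0 ?ltr_wpDl ?mulr_ge0 ?ltW.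
- by field; rewrite k0 gt_eqF.
Unshelve. all: by end_near. Qed.
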